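(* Let $E$ be a Banach lattice and $X$ a Banach space. Every Dunford-Pettis operator $T:E\to X$ is $b$-weakly compact.
   Context: Operators are linear. An operator $T$ between Banach spaces is Dunford-Pettis if $x_n\to 0$ weakly implies $\|Tx_n\|\to 0$. An operator from a Banach lattice $E$ into a Banach space $X$ is $b$-weakly compact if it maps each subset of $E$ that is $b$-order bounded (i.e. order bounded in the topological bidual $E''$, where $E$ is viewed in $E''$ canonically) onto a relatively weakly compact subset of $X$. *)

(* Defs.v *)
From HB Require Import structures.
From mathcomp Require Import all_boot all_order all_algebra.
From mathcomp Require Import all_classical all_reals all_analysis.

Set Implicit Arguments.
Unset Strict Implicit.
Unset Printing Implicit Defensive.

Import Order.TTheory GRing.Theory Num.Theory.
Import numFieldNormedType.Exports.

Local Open Scope classical_set_scope.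
Local Open Scope ring_scope.

(* The order and the lattice operations are fields: the hierarchy of structures
   has no common substructure of normed modules and of (pre)orders other than
   [numDomainType], so a join with [latticeType] or [porderType] is rejected.
   In the last axiom [bl_join x (- x)] is the modulus of [x]; [`|x|] is its
   norm. *)
HB.mixin Record CompleteNormedModule_isBanachLattice
    (R : realType) E & CompleteNormedModule R E := {
  bl_le : E -> E -> Prop ;
  bl_join : E -> E -> E ;
  bl_meet : E -> E -> E ;
  bl_le_refl : forall x : E, bl_le x x ;
  bl_le_anti : forall x y : E, bl_le x y -> bl_le y x -> x = y ;
  bl_le_trans : forall y x z : E, bl_le x y -> bl_le y z -> bl_le x z ;
  bl_join_lub : forall x y z : E,
    bl_le (bl_join x y) z <-> bl_le x z /\ bl_le y z ;
  bl_meet_glb : forall x y z : E,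
    bl_le z (bl_meet x y) <-> bl_le z x /\ bl_le z y ;
  bl_leD2r : forall z x y : E, bl_le x y -> bl_le (x + z) (y + z) ;
  bl_scale_ge0 : forall (a : R) (x : E), 0 <= a -> bl_le 0 x -> bl_le 0 (a *: x) ;
  bl_le_norm : forall x y : E,
    bl_le (bl_join x (- x)) (bl_join y (- y)) -> `|x| <= `|y|
}.

#[short(type="banachLatticeType")]
HB.structure Definition BanachLattice (R : realType) :=
  {E of CompleteNormedModule R E & CompleteNormedModule_isBanachLattice R E}.

Section dual.
Context {R : realType} (V : normedModType R).

Definition dual_pred : {pred V -> R^o} :=
  fun f => `[< linear f /\ continuous f >].

Record dual := Dual { dual_fun :> V -> R^o ; _ : dual_fun \in dual_pred }.

HB.instance Definition _ := [isSub for dual_fun].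
HB.instance Definition _ := [Choice of dual by <:].

Lemma dual_submod_closed : submod_closed dual_pred.
Proof.
split.
  apply/asboolP; split=> [a x y|x]; last exact: cvg_cst.
  by rewrite /= scaler0 addr0.
move=> a f g /asboolP[lf cf] /asboolP[lg cg]; apply/asboolP; split=> [b x y|x].
  rewrite /= !fctE lf lg !scalerDr -!addrA; congr (_ + _).
    by rewrite !scalerA mulrC.
  by rewrite addrCA.
by apply: cvgD; [apply: cvgZr; exact: cf|exact: cg].
Qed.

HB.instance Definition _ :=
  GRing.isSubmodClosed.Build _ _ dual_pred dual_submod_closed.
HB.instance Definition _ := [SubChoice_isSubLmodule of dual by <:].

Lemma dual_linear (f : dual) : linear f.
Proof. by have /asboolP[] := valP f. Qed.

HB.instance Definition _ (f : dual) :=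
  GRing.isLinear.Build R V R^o _ (dual_fun f) (dual_linear f).

Lemma dual_continuous (f : dual) : continuous f.
Proof. by have /asboolP[] := valP f. Qed.

Definition dual_norm (f : dual) : R :=
  sup [set `|f x| | x in [set x : V | `|x| <= 1]].

Lemma dual_has_sup (f : dual) :
  has_sup [set `|f x| | x in [set x : V | `|x| <= 1]].
Proof.
split; first by exists `|f 0|, 0; rewrite //= normr0.
have := continuous_linear_bounded 0 (@dual_continuous f 0).
move=> /bounded_funP /(_ 1)[M fM].
by exists M => _ [x /= x1 <-]; exact: fM.
Qed.

Lemma dual_norm_ub (f : dual) (x : V) : `|x| <= 1 -> `|f x| <= dual_norm f.
Proof. by move=> x1; apply: sup_upper_bound (dual_has_sup f) _ _; exists x. Qed.

Lemma dual_norm_lub (f : dual) (M : R) :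
  (forall x : V, `|x| <= 1 -> `|f x| <= M) -> dual_norm f <= M.
Proof.
move=> fM; apply: ge_sup; first by case: (dual_has_sup f).
by move=> _ [x /= x1 <-]; exact: fM.
Qed.

Lemma ler_dual_norm (f : dual) (x : V) : `|f x| <= dual_norm f * `|x|.
Proof.
have [->|x0] := eqVneq x 0; first by rewrite linear0 !normr0 mulr0.
have nx0 : 0 < `|x| by rewrite normr_gt0.
rewrite -ler_pdivrMr// mulrC.
have -> : `|x|^-1 * `|f x| = `|f (`|x|^-1 *: x)|.
  by rewrite linearZ /= normrZ ger0_norm// invr_ge0.
by apply: dual_norm_ub; rewrite normrZ normfV normr_id mulVf// gt_eqF.
Qed.

Lemma dual_normD f g : dual_norm (f + g) <= dual_norm f + dual_norm g.
Proof.
apply: dual_norm_lub => x x1; apply: (le_trans (ler_normD _ _)).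
by apply: lerD; exact: dual_norm_ub.
Qed.

Lemma dual_norm_ge0 f : 0 <= dual_norm f.
Proof. by apply: le_trans (dual_norm_ub (x := 0) f _); rewrite ?normr0. Qed.

Lemma dual_normZ (a : R) f : dual_norm (a *: f) = `|a| * dual_norm f.
Proof.
have le b g : dual_norm (b *: g) <= `|b| * dual_norm g.
  apply: dual_norm_lub => x x1; rewrite [leLHS]normrM ler_wpM2l//.
  exact: dual_norm_ub.
apply/eqP; rewrite eq_le le/=; have [->|a0] := eqVneq a 0.
  by rewrite normr0 mul0r dual_norm_ge0.
rewrite -ler_pdivlMl ?normr_gt0// -normfV.
by rewrite -[X in dual_norm X <= _](scalerK a0) le.
Qed.

Lemma dual_norm0_eq0 f : dual_norm f = 0 -> f = 0.
Proof.
move=> f0; apply: val_inj; apply/funext => x.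
by apply/normr0_eq0/le_anti; rewrite normr_ge0 (le_trans (ler_dual_norm _ _))// f0 mul0r.
Qed.

HB.instance Definition _ :=
  Lmodule_isNormed.Build R dual dual_normD dual_normZ dual_norm0_eq0.

End dual.

Section bidual_embedding.
Context {R : realType} (V : normedModType R).

Definition eval_fun (x : V) : dual V -> R^o := fun f => f x.

Lemma eval_fun_linear x : linear (eval_fun x).
Proof. by []. Qed.

Lemma eval_fun_continuous x : continuous (eval_fun x).
Proof.
pose L : {linear dual V -> R^o} :=
  HB.pack (eval_fun x) (GRing.isLinear.Build _ _ _ _ _ (eval_fun_linear x)).
apply: (bounded_linear_continuous (f := L)); apply/bounded_funP => r.
exists (r * `|x|) => f fr; apply: (le_trans (ler_dual_norm f x)).
exact: ler_wpM2r.
Qed.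

Lemma eval_fun_dual x : eval_fun x \in @dual_pred R (dual V).
Proof. by apply/asboolP; split; [|exact: eval_fun_continuous]. Qed.

Definition bidual_embed (x : V) : dual (dual V) := Dual (eval_fun_dual x).

End bidual_embedding.

Section weak.
Context {R : realType}.

Definition weak (V : normedModType R) : Type := V.

HB.instance Definition _ (V : normedModType R) :=
  Topological.copy (weak V)
    (sup_topology (fun f : dual V =>
       Topological.class (initial_topology (dual_fun f)))).

Definition relatively_weakly_compact (V : normedModType R) (A : set V) :=
  compact (closure (A : set (weak V))).

Definition dunford_pettis (E X : completeNormedModType R)
    (T : {linear E -> X}) :=
  forall x : nat -> E,
    (x : nat -> weak E) @ \oo --> ((0 : E) : weak E) ->
    `|T (x n)| @[n --> \oo] --> (0 : R).

End weak.

Section b_weakly_compact.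
Context {R : realType} (E : banachLatticeType R).

Definition dual_le (f g : dual E) := forall x : E, bl_le 0 x -> f x <= g x.

Definition bidual_le (phi psi : dual (dual E)) :=
  forall f : dual E, dual_le 0 f -> phi f <= psi f.

Definition b_order_bounded (A : set E) :=
  exists phi psi : dual (dual E), forall x, A x ->
    bidual_le phi (bidual_embed x) /\ bidual_le (bidual_embed x) psi.

Definition b_weakly_compact (X : completeNormedModType R)
    (T : {linear E -> X}) :=
  forall A : set E, b_order_bounded A -> relatively_weakly_compact (T @` A).

End b_weakly_compact.

(* Main.v *)
(* Let [C] be the set of the [x >= 0] of [E] below [psi - phi] in the bidual: it
   is solid, norm bounded, and, by the Hahn-Banach theorem, closed under finite
   suprema; any two elements of the given set differ by some [x] with [|x|] in
   [C]. If [z n >= 0] has bounded partial sums and [|y n| <= z n], then choosing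
   signs shows that [y] is weakly null, so [T (y n)] tends to 0. Hence monotone
   sequences of [C] are Cauchy for the seminorm [p x = sup {|T y| : |y| <= x}].
   It follows that on [C] the seminorm [p] is small wherever a suitable finite
   sum [f] of moduli of functionals [g o T] is small.
   Relative weak compactness is reduced to filters with a base of midpoint-convex
   sets: nearly minimizing along such a filter an energy that is uniformly convex
   for [f] yields a finer one containing a set of small [T]-diameter. Iterating
   gives a filter whose image converges in norm to some [l]; if the ultrafilter
   at hand did not converge weakly to [l], it would contain an open half-space
   at positive distance from [l]. *)
Require Import Defs.
From HB Require Import structures.
From mathcomp Require Import all_boot all_order all_algebra.
From mathcomp Require Import all_classical all_reals all_analysis.
From mathcomp Require Import ring lra.

Set Implicit Arguments.
Unset Strict Implicit.
Unset Printing Implicit Defensive.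

Import Order.TTheory GRing.Theory Num.Theory.
Import numFieldNormedType.Exports.

Local Open Scope classical_set_scope.
Local Open Scope ring_scope.

(** * The Hahn-Banach theorem, by minimal sublinear functionals *)

Section hahn_banach.
Context {R : realType} {V : lmodType R}.
Implicit Types (p q : V -> R) (x y : V).

Definition sublinear p :=
  (forall x y, p (x + y) <= p x + p y) /\
  (forall (a : R) x, 0 <= a -> p (a *: x) = a * p x).

Lemma sublinearW p : p 0 = 0 -> (forall x y, p (x + y) <= p x + p y) ->
  (forall (a : R) x, 0 < a -> p (a *: x) <= a * p x) -> sublinear p.
Proof.
move=> p0 pD pZ; split=> // a x; rewrite le_eqVlt => /predU1P[<-|a0].
  by rewrite scale0r mul0r.
apply/eqP; rewrite eq_le pZ//= -ler_pdivlMl//.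
by rewrite -[X in p X <= _](scalerK (lt0r_neq0 a0)) pZ// invr_gt0.
Qed.

Lemma sublinear0 p : sublinear p -> p 0 = 0.
Proof. by case=> _ pZ; rewrite -(scale0r 0) pZ// mul0r. Qed.

Lemma sublinear_ge p x : sublinear p -> - p (- x) <= p x.
Proof.
move=> sp; have [pD _] := sp; have := pD x (- x).
by rewrite subrr (sublinear0 sp); lra.
Qed.

(* The largest sublinear functional below [p] that is at most [- p y] at
   [- y]. *)
Definition tilt p y x :=
  inf [set p (x + t *: y) - t * p y | t in [set t | 0 <= t]].

Lemma tilt_lb p y x : sublinear p ->
  lbound [set p (x + t *: y) - t * p y | t in [set t | 0 <= t]] (- p (- x)).
Proof.
move=> [pD pZ] _ [t /= t0 <-]; rewrite -pZ//.
by have := pD (x + t *: y) (- x); rewrite addrAC subrr add0r; lra.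
Qed.

Lemma tilt_le p y x t : sublinear p -> 0 <= t ->
  tilt p y x <= p (x + t *: y) - t * p y.
Proof.
by move=> sp t0; apply: ge_inf; [exists (- p (- x)); exact: tilt_lb|exists t].
Qed.

Lemma tilt_ge p y x c :
  (forall t, 0 <= t -> c <= p (x + t *: y) - t * p y) -> c <= tilt p y x.
Proof.
move=> H; apply: lb_le_inf; first by exists (p (x + 0 *: y) - 0 * p y), 0 => /=.
by move=> _ [t /= t0 <-]; exact: H.
Qed.

Lemma tilt_sublinear p y : sublinear p -> sublinear (tilt p y).
Proof.
move=> sp; have [pD pZ] := sp; apply: sublinearW.
- apply/eqP; rewrite eq_le; apply/andP; split.
    apply: (le_trans (tilt_le y 0 sp (lexx 0))).
    by rewrite scale0r addr0 mul0r subr0 (sublinear0 sp).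
  by apply: tilt_ge => t t0; rewrite add0r pZ// subrr.
- move=> x1 x2; rewrite -lerBlDr; apply: tilt_ge => t1 t10.
  rewrite lerBlDl -lerBlDr; apply: tilt_ge => t2 t20; rewrite lerBlDl.
  apply: (le_trans (tilt_le y (x1 + x2) sp (addr_ge0 t10 t20))).
  have := pD (x1 + t1 *: y) (x2 + t2 *: y).
  by rewrite scalerDl addrACA; lra.
- move=> a x a0; rewrite -ler_pdivrMl//; apply: tilt_ge => t t0.
  rewrite ler_pdivrMl//.
  have := tilt_le y (a *: x) sp (mulr_ge0 (ltW a0) t0).
  by rewrite -scalerA -scalerDr (pZ _ _ (ltW a0)); lra.
Qed.

Lemma tilt_le_self p y x : sublinear p -> tilt p y x <= p x.
Proof.
by move=> sp; have := tilt_le y x sp (lexx 0); rewrite scale0r addr0; lra.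
Qed.

Lemma tilt_opp p y : sublinear p -> tilt p y (- y) <= - p y.
Proof.
move=> sp; have := tilt_le y (- y) sp ler01.
by rewrite scale1r addNr (sublinear0 sp); lra.
Qed.

Lemma minimal_sublinear p : sublinear p ->
  exists2 q, sublinear q /\ (forall x, q x <= p x) &
  forall r, sublinear r -> (forall x, r x <= q x) -> forall x, q x <= r x.
Proof.
move=> sp; pose S := {q : V -> R | sublinear q /\ (forall x, q x <= p x)}.
(* The order is reversed, so that the maximal elements given by Zorn's lemma are minimal
   functionals. *)
pose leS (q r : S) := `[< forall x, sval r x <= sval q x >].
have lb (q : S) x : - p (- x) <= sval q x.
  case: q => q /= [sq qp]; apply: (le_trans _ (sublinear_ge x sq)).
  by rewrite lerN2.
pose p0 : S := exist _ p (conj sp (fun=> lexx _)).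
have [||A Atot|[q [sq qp]] qmin] := @ZL_preorder S p0 leS.
- by move=> q; apply/asboolP => x.
- move=> q r s /asboolP qr /asboolP rs; apply/asboolP => x.
  exact: le_trans (rs x) (qr x).
- have [[q0 Aq0]|A0] := pselect (A !=set0); last first.
    by exists p0 => s As; exfalso; apply: A0; exists s.
  (* A nonempty chain is bounded by its pointwise infimum, which is finite because all its members
     stay above [- p (- x)]. *)
  pose r x := inf [set sval (q : S) x | q in A].
  have rle (q : S) x : A q -> r x <= sval q x.
    move=> Aq; apply: ge_inf; last by exists q.
    by exists (- p (- x)) => _ [s _ <-].
  have rge c x : (forall q : S, A q -> c <= sval q x) -> c <= r x.
    move=> H; apply: lb_le_inf; first by exists (sval q0 x), q0.
    by move=> _ [s As <-]; exact: H.
  have sr : sublinear r.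
    apply: sublinearW.
    + apply/eqP; rewrite eq_le; apply/andP; split.
        by apply: (le_trans (rle _ _ Aq0)); rewrite (sublinear0 (svalP q0).1).
      by apply: (rge) => q Aq; rewrite (sublinear0 (svalP q).1).
    + move=> x1 x2; rewrite -lerBlDr; apply: (rge) => q Aq.
      rewrite lerBlDl -lerBlDr; apply: (rge) => s As; rewrite lerBlDl.
      (* Two members of a chain are comparable; subadditivity of the smaller one serves at both
         points. *)
      have [/asboolP qs|/asboolP sq] := Atot _ _ Aq As.
        have := qs x1; have := (svalP s).1.1 x1 x2; have := rle _ (x1 + x2) As; lra.
      have := sq x2; have := (svalP q).1.1 x1 x2; have := rle _ (x1 + x2) Aq; lra.
    + move=> a x a0; rewrite -ler_pdivrMl//; apply: (rge) => q Aq.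
      by rewrite ler_pdivrMl// -((svalP q).1.2 _ _ (ltW a0)) rle.
  have rp x : r x <= p x by apply: (le_trans (rle _ _ Aq0)); exact: (svalP q0).2.
  exists (exist _ r (conj sr rp)) => s As; apply/asboolP => x /=; exact: rle.
exists q => // r sr rq x.
have rp y : r y <= p y by exact: le_trans (rq y) (qp y).
have /asboolP := qmin (exist _ r (conj sr rp)) (asboolT rq); exact.
Qed.

(* A minimal sublinear functional coincides with all its tilts, hence is odd. *)
Theorem hahn_banach p x0 : sublinear p ->
  exists f : {linear V -> R^o}, (forall x, f x <= p x) /\ f x0 = p x0.
Proof.
(* Minimizing below the tilt of [p] at [x0] forces the value at [- x0] to be at most [- p x0]; since
   [q] is odd, this gives equality at [x0]. *)
move=> sp; have [q [sq qp] qmin] := minimal_sublinear (tilt_sublinear x0 sp).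
have qN y : q (- y) = - q y.
  apply/eqP; rewrite eq_le; apply/andP; split; last first.
    by have := sublinear_ge (- y) sq; rewrite opprK.
  have [qt] := (tilt_sublinear y sq, fun x => tilt_le_self y x sq).
  move=> /(qmin _ qt)/(_ (- y)) /le_trans; apply; exact: tilt_opp.
have qD x y : q (x + y) = q x + q y.
  apply/eqP; rewrite eq_le sq.1/=.
  have := sq.1 (x + y) (- y); rewrite addrK qN; lra.
have ql : linear (q : V -> R^o).
  move=> a x y; rewrite qD; congr (_ + _).
  have [a0|/ltW a0] := leP 0 a; first exact: sq.2.
  by rewrite -[a]opprK scaleNr qN sq.2 ?oppr_ge0// scaleNr.
pose f : {linear V -> R^o} := HB.pack (q : V -> R^o) (GRing.isLinear.Build _ _ _ _ _ ql).
exists f; split=> [x|].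
  exact: le_trans (qp x) (tilt_le_self x0 x sp).
apply/eqP; rewrite eq_le (le_trans (qp x0) (tilt_le_self x0 x0 sp))/=.
have := le_trans (qp (- x0)) (tilt_opp x0 sp); rewrite qN lerN2; exact.
Qed.

End hahn_banach.

(** * Order and lattice calculus in a Banach lattice *)

Arguments bl_le_trans {R s y x z}.
Arguments bl_le_anti {R s x y}.
Arguments bl_leD2r {R s} z {x y}.
Arguments bl_scale_ge0 {R s a x}.

Definition bl_mod {R : realType} {E : banachLatticeType R} (x : E) := bl_join x (- x).
Definition bl_pos {R : realType} {E : banachLatticeType R} (x : E) := bl_join x 0.

Section banach_lattice_order.
Context {R : realType} {E : banachLatticeType R}.
Implicit Types x y z w a b c : E.

Lemma bl_leP0 x y : bl_le x y <-> bl_le 0 (y - x).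
Proof.
split=> h; first by rewrite -(subrr x); exact: bl_leD2r.
by have := bl_leD2r x h; rewrite add0r subrK.
Qed.

Lemma bl_leD x y z w : bl_le x y -> bl_le z w -> bl_le (x + z) (y + w).
Proof.
move=> xy zw; apply: (bl_le_trans (bl_leD2r z xy)).
by rewrite ![y + _]addrC; exact: bl_leD2r.
Qed.

Lemma bl_leBlDr x y z : bl_le (x - y) z <-> bl_le x (z + y).
Proof. by rewrite bl_leP0 [in X in _ <-> X]bl_leP0 opprB addrA. Qed.

Lemma bl_leN2 x y : bl_le x y -> bl_le (- y) (- x).
Proof. by rewrite bl_leP0 => h; rewrite bl_leP0 opprK addrC. Qed.

Lemma bl_leNl x y : bl_le (- x) y -> bl_le (- y) x.
Proof. by move=> /bl_leN2; rewrite opprK. Qed.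

Lemma bl_geN x : bl_le 0 x -> bl_le (- x) x.
Proof.
by move=> x0; apply: bl_le_trans (x0); have := bl_leN2 x0; rewrite oppr0.
Qed.

Lemma bl_addr_ge0 x y : bl_le 0 x -> bl_le 0 y -> bl_le 0 (x + y).
Proof. by move=> x0 y0; rewrite -(addr0 0); exact: bl_leD. Qed.

Lemma bl_leZ (t : R) x y : 0 <= t -> bl_le x y -> bl_le (t *: x) (t *: y).
Proof. by move=> t0 /bl_leP0 h; apply/bl_leP0; rewrite -scalerBr; exact: bl_scale_ge0. Qed.

Lemma bl_leZK (t : R) x y : 0 < t -> bl_le (t *: x) (t *: y) -> bl_le x y.
Proof.
move=> t0 /(bl_leZ (ltW (_ : 0 < t^-1))); rewrite invr_gt0 => /(_ t0).
by rewrite !scalerK ?gt_eqF.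
Qed.

Lemma bl_sum_ge0 (u : nat -> E) n : (forall k, bl_le 0 (u k)) ->
  bl_le 0 (\sum_(k < n) u k).
Proof.
by move=> u0; elim/big_ind: _ => //; [exact: bl_le_refl|exact: bl_addr_ge0].
Qed.

Lemma bl_joinl x y : bl_le x (bl_join x y).
Proof. by have [] := (bl_join_lub x y (bl_join x y)).1 (bl_le_refl _). Qed.

Lemma bl_joinr x y : bl_le y (bl_join x y).
Proof. by have [] := (bl_join_lub x y (bl_join x y)).1 (bl_le_refl _). Qed.

Lemma bl_join_le x y z : bl_le x z -> bl_le y z -> bl_le (bl_join x y) z.
Proof. by move=> xz yz; apply/bl_join_lub. Qed.

Lemma bl_meetl x y : bl_le (bl_meet x y) x.
Proof. by have [] := (bl_meet_glb x y (bl_meet x y)).1 (bl_le_refl _). Qed.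

Lemma bl_meetr x y : bl_le (bl_meet x y) y.
Proof. by have [] := (bl_meet_glb x y (bl_meet x y)).1 (bl_le_refl _). Qed.

Lemma bl_le_meet x y z : bl_le z x -> bl_le z y -> bl_le z (bl_meet x y).
Proof. by move=> zx zy; apply/bl_meet_glb. Qed.

Lemma bl_meetDjoin x y : bl_meet x y + bl_join x y = x + y.
Proof.
have /bl_le_anti : bl_le (bl_meet x y) (x + y - bl_join x y).
  suff : bl_le (bl_join x y) (x + y - bl_meet x y).
    by rewrite bl_leP0 addrAC -bl_leP0.
  apply: bl_join_le; rewrite bl_leP0.
    by rewrite addrAC (addrC x) addrK -bl_leP0; exact: bl_meetr.
  by rewrite addrAC addrK -bl_leP0; exact: bl_meetl.
move=> ->; first by rewrite subrK.
apply: bl_le_meet; rewrite bl_leBlDr addrC.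
  by rewrite ![_ + x]addrC; apply: bl_leD (bl_le_refl _) (bl_joinr _ _).
by rewrite addrC [x + y]addrC; apply: bl_leD (bl_le_refl _) (bl_joinl _ _).
Qed.

(** This stands in for distributivity. For [d] equal to [a] or [b], [d + w] is the sum of the meet
    and the join of [d] and [w], hence at most [c + bl_join a b]; taking the join over both [d] and
    cancelling [bl_join a b] leaves [w] below [c]. *)
Lemma bl_join_case w a b c : bl_le w (bl_join a b) ->
  (forall x, bl_le x w -> bl_le x a -> bl_le x c) ->
  (forall x, bl_le x w -> bl_le x b -> bl_le x c) -> bl_le w c.
Proof.
move=> wab ca cb.
have H d : bl_le d (bl_join a b) ->
    (forall x, bl_le x w -> bl_le x d -> bl_le x c) -> bl_le (d + w) (c + bl_join a b).
  move=> dab cd; rewrite -bl_meetDjoin; apply: bl_leD.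
    by apply: cd; [exact: bl_meetr|exact: bl_meetl].
  exact: bl_join_le.
have : bl_le (bl_join a b) (c + bl_join a b - w).
  by apply: bl_join_le; rewrite bl_leP0 addrAC -addrA -opprD -bl_leP0;
    apply: H => //; [exact: bl_joinl|exact: bl_joinr].
by rewrite bl_leP0 addrAC addrK -bl_leP0.
Qed.

Lemma bl_le_mod x : bl_le x (bl_mod x).
Proof. exact: bl_joinl. Qed.

Lemma bl_leN_mod x : bl_le (- x) (bl_mod x).
Proof. exact: bl_joinr. Qed.

Lemma bl_mod_le x y : bl_le x y -> bl_le (- x) y -> bl_le (bl_mod x) y.
Proof. exact: bl_join_le. Qed.

Lemma bl_modN x : bl_mod (- x) = bl_mod x.
Proof.
by rewrite /bl_mod opprK; apply: bl_le_anti; apply: bl_join_le;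
  (exact: bl_joinl || exact: bl_joinr).
Qed.

Lemma bl_half x : 2^-1 *: x + 2^-1 *: x = x.
Proof. by rewrite -scalerDl [X in X *: _](_ : _ = 1) ?scale1r//; lra. Qed.

Lemma bl_mod_ge0 x : bl_le 0 (bl_mod x).
Proof.
rewrite -(bl_half (bl_mod x)) -scalerDr; apply: bl_scale_ge0.
  by rewrite invr_ge0.
by rewrite -(subrr x); apply: bl_leD (bl_le_mod x) (bl_leN_mod x).
Qed.

Lemma bl_modD x y : bl_le (bl_mod (x + y)) (bl_mod x + bl_mod y).
Proof.
apply: bl_mod_le; first exact: bl_leD (bl_le_mod x) (bl_le_mod y).
by rewrite opprD; apply: bl_leD (bl_leN_mod x) (bl_leN_mod y).
Qed.

Lemma bl_mod_id x : bl_le 0 x -> bl_mod x = x.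
Proof.
move=> x0; apply: bl_le_anti; last exact: bl_le_mod.
apply: bl_mod_le; first exact: bl_le_refl.
exact: bl_geN.
Qed.

Lemma bl_modZ_le (t : R) x : 0 <= t -> bl_le (bl_mod (t *: x)) (t *: bl_mod x).
Proof.
move=> t0; apply: bl_mod_le; last rewrite -scalerN.
  exact: bl_leZ (bl_le_mod x).
exact: bl_leZ (bl_leN_mod x).
Qed.

Lemma bl_norm_le x y : bl_le (bl_mod x) y -> `|x| <= `|y|.
Proof.
move=> xy; apply: bl_le_norm; rewrite -/(bl_mod y) bl_mod_id//.
exact: bl_le_trans (bl_mod_ge0 x) xy.
Qed.

Lemma bl_pos_ge0 x : bl_le 0 (bl_pos x).
Proof. exact: bl_joinr. Qed.

Lemma bl_le_pos x : bl_le x (bl_pos x).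
Proof. exact: bl_joinl. Qed.

Lemma bl_pos_le x y : bl_le x y -> bl_le 0 y -> bl_le (bl_pos x) y.
Proof. exact: bl_join_le. Qed.

Lemma bl_joinBpos x y : bl_join x y = x + bl_pos (y - x).
Proof.
apply: bl_le_anti.
  apply: bl_join_le.
    by rewrite -{1}(addr0 x); apply: bl_leD (bl_le_refl _) (bl_pos_ge0 _).
  by rewrite addrC -bl_leBlDr; exact: bl_le_pos.
suff : bl_le (bl_pos (y - x)) (bl_join x y - x).
  by rewrite bl_leP0 -addrA -opprD -bl_leP0.
by apply: bl_pos_le; [apply: bl_leD2r; exact: bl_joinr|
  rewrite -bl_leP0; exact: bl_joinl].
Qed.

(** The part [u] is [y] truncated to the order interval from [- a] to [a]. *)
Lemma bl_riesz_decomposition a b y : bl_le 0 a -> bl_le 0 b ->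
  bl_le (bl_mod y) (a + b) ->
  exists u v, [/\ y = u + v, bl_le (bl_mod u) a & bl_le (bl_mod v) b].
Proof.
move=> a0 b0 yab.
have yle : bl_le y (a + b) := bl_le_trans (bl_le_mod y) yab.
have nyle : bl_le (- y) (a + b) := bl_le_trans (bl_leN_mod y) yab.
have Na : bl_le (- a) a.
  exact: bl_geN.
pose u := bl_join (bl_meet y a) (- a).
exists u, (y - u); split; first by rewrite addrCA subrr addr0.
  apply: bl_mod_le; first by apply: bl_join_le Na; exact: bl_meetr.
  by apply: bl_leNl; exact: bl_joinr.
apply: bl_mod_le.
  rewrite bl_leBlDr addrC -bl_leBlDr; apply: bl_le_trans (bl_joinl _ _).
  apply: bl_le_meet.
    by rewrite bl_leBlDr -{1}(addr0 y); exact: bl_leD (bl_le_refl _) b0.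
  by rewrite bl_leBlDr.
rewrite opprB bl_leBlDr; apply: bl_join_le.
  apply: (bl_le_trans (bl_meetl _ _)).
  by rewrite -{1}(add0r y); exact: bl_leD2r.
by apply: bl_leNl; rewrite addrC opprD bl_leBlDr.
Qed.

Lemma bl_le_addr x y : bl_le 0 y -> bl_le x (x + y).
Proof. by move=> y0; rewrite -{1}(addr0 x); apply: bl_leD (bl_le_refl x) y0. Qed.

Lemma bl_le_addl x y : bl_le 0 y -> bl_le x (y + x).
Proof. by move=> y0; rewrite addrC; exact: bl_le_addr. Qed.

Lemma bl_pos_meet_le x y z :
  bl_le (bl_pos (x - bl_meet y z)) (bl_pos (x - y) + bl_pos (x - z)).
Proof.
have H a s : bl_le (x - a) s -> bl_le (x - s) a.
  by move=> /bl_leBlDr xa; apply/bl_leBlDr; rewrite addrC.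
apply: bl_pos_le; last by apply: bl_addr_ge0; exact: bl_pos_ge0.
apply: (H); apply: bl_le_meet; apply: H.
  exact: bl_le_trans (bl_le_pos _) (bl_le_addr _ (bl_pos_ge0 _)).
exact: bl_le_trans (bl_le_pos _) (bl_le_addl _ (bl_pos_ge0 _)).
Qed.

(** What the analysis of [T] retains of the positive elements of [E] below a fixed element of the
    bidual. *)
Definition solid_directed (C : set E) :=
  [/\ forall x, C x -> bl_le 0 x,
      forall x y, C x -> bl_le 0 y -> bl_le y x -> C y,
      forall x y, C x -> C y -> C (bl_join x y) &
      exists M, forall x, C x -> `|x| <= M].


Fixpoint join_run (v : nat -> E) m :=
  if m is m'.+1 then bl_join (join_run v m') (v m) else v 0%N.

Lemma join_run_mono (v : nat -> E) m n : (m <= n)%N ->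
  bl_le (join_run v m) (join_run v n).
Proof.
move=> /subnKC <-; elim: (n - m)%N => [|k IHk]; first by rewrite addn0; exact: bl_le_refl.
by rewrite addnS; exact: bl_le_trans IHk (bl_joinl _ _).
Qed.

Lemma le_join_run (v : nat -> E) m k : (k <= m)%N -> bl_le (v k) (join_run v m).
Proof.
move=> km; apply: bl_le_trans (join_run_mono v km).
by case: k {km} => [|k]; [exact: bl_le_refl|exact: bl_joinr].
Qed.

Lemma join_run_le_sum (v : nat -> E) m : (forall k, bl_le 0 (v k)) ->
  bl_le (join_run v m) (\sum_(k < m.+1) v k).
Proof.
move=> v0; elim: m => [|m IHm].
  by rewrite big_ord_recr big_ord0/= add0r; exact: bl_le_refl.
rewrite big_ord_recr; apply: bl_join_le.
  exact: bl_le_trans IHm (bl_le_addr _ (v0 _)).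
exact/bl_le_addl/bl_sum_ge0.
Qed.

Fixpoint meet_run (v : nat -> E) m :=
  if m is m'.+1 then bl_meet (meet_run v m') (v m) else v 0%N.

Lemma meet_run_mono (v : nat -> E) m n : (m <= n)%N ->
  bl_le (meet_run v n) (meet_run v m).
Proof.
move=> /subnKC <-; elim: (n - m)%N => [|k IHk]; first by rewrite addn0; exact: bl_le_refl.
by rewrite addnS; exact: bl_le_trans (bl_meetl _ _) IHk.
Qed.

Lemma meet_run_le (v : nat -> E) m : bl_le (meet_run v m) (v m).
Proof. by case: m => [|m]; [exact: bl_le_refl|exact: bl_meetr]. Qed.

Section runs_in_solid_directed.
Variable C : set E.
Hypothesis C_solid : solid_directed C.

Lemma join_runP (v : nat -> E) m : (forall k, C (v k)) -> C (join_run v m).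
Proof.
move=> Cv; have [_ _ Cj _] := C_solid.
by elim: m => //= m IHm; exact: Cj.
Qed.

Lemma meet_runP (v : nat -> E) m : (forall k, C (v k)) -> C (meet_run v m).
Proof.
move=> Cv; have [C0 Cs _ _] := C_solid.
elim: m => //= m IHm; apply: (Cs (v m.+1)) => //; last exact: bl_meetr.
by apply: bl_le_meet; exact: C0.
Qed.

End runs_in_solid_directed.

End banach_lattice_order.

(** * Solid envelopes of subadditive functionals *)

Section solid_envelope.
Context {R : realType} {E : banachLatticeType R}.
Implicit Types (q : E -> R) (x y z : E).

Definition bounded_subadditive q :=
  [/\ forall x y, q (x + y) <= q x + q y, forall x, 0 <= q x &
      exists2 L, 0 <= L & forall x, q x <= L * `|x|].

(** Meant for [x] in the positive cone. For [q y = |l y|] with [l] a bounded functional this is the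
    Riesz-Kantorovich formula for the modulus of [l]. *)
Definition envelope q x := sup [set q y | y in [set y | bl_le (bl_mod y) x]].

Lemma envelope_ub q x y : bounded_subadditive q -> bl_le (bl_mod y) x ->
  q y <= envelope q x.
Proof.
move=> [_ _ [L L0 qL]] yx; apply: sup_upper_bound; last by exists y.
split; first by exists (q y), y.
exists (L * `|x|) => _ [z /= zx <-]; apply: (le_trans (qL z)).
exact/ler_wpM2l/bl_norm_le.
Qed.

Lemma envelope_lub q x c : bl_le 0 x ->
  (forall y, bl_le (bl_mod y) x -> q y <= c) -> envelope q x <= c.
Proof.
move=> x0 H; apply: ge_sup; last by move=> _ [y /= yx <-]; exact: H.
by exists (q x), x => //=; rewrite bl_mod_id//; exact: bl_le_refl.
Qed.

Lemma envelope_gt q x c : bl_le 0 x -> c < envelope q x ->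
  exists2 y, bl_le (bl_mod y) x & c < q y.
Proof.
move=> x0 cx; apply: contrapT => H; move: cx; apply/negP; rewrite -leNgt.
by apply: envelope_lub => // y yx; rewrite leNgt; apply/negP => cy; apply: H; exists y.
Qed.

Lemma envelope_ge0 q x : bounded_subadditive q -> bl_le 0 x -> 0 <= envelope q x.
Proof.
move=> bq x0; have [_ q0 _] := bq; apply: (le_trans (q0 x)).
by apply: envelope_ub => //; rewrite bl_mod_id//; exact: bl_le_refl.
Qed.

Lemma envelope_mod q y : bounded_subadditive q -> q y <= envelope q (bl_mod y).
Proof. by move=> bq; apply: envelope_ub => //; exact: bl_le_refl. Qed.

Lemma envelope_mono q x z : bounded_subadditive q -> bl_le 0 x -> bl_le x z ->
  envelope q x <= envelope q z.
Proof.
move=> bq x0 xz; apply: envelope_lub => // y yx.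
by apply: envelope_ub => //; exact: bl_le_trans yx xz.
Qed.

Lemma envelope_le q r x : bounded_subadditive r -> bl_le 0 x ->
  (forall y, q y <= r y) -> envelope q x <= envelope r x.
Proof.
move=> br x0 qr; apply: envelope_lub => // y yx.
exact: le_trans (qr y) (envelope_ub br yx).
Qed.

Lemma envelopeD q x z : bounded_subadditive q -> bl_le 0 x -> bl_le 0 z ->
  envelope q (x + z) <= envelope q x + envelope q z.
Proof.
move=> bq x0 z0; apply: envelope_lub => [|y]; first exact: bl_addr_ge0.
move=> /(bl_riesz_decomposition x0 z0)[u [v [-> ux vz]]].
have [qD _ _] := bq; apply: (le_trans (qD u v)).
by apply: lerD; exact: envelope_ub.
Qed.

Lemma envelope0 q : bounded_subadditive q -> envelope q 0 = 0.
Proof.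
move=> bq; apply/eqP; rewrite eq_le envelope_ge0 ?andbT//; last exact: bl_le_refl.
have [_ _ [L L0 qL]] := bq; apply: envelope_lub => [|y y0]; first exact: bl_le_refl.
apply: (le_trans (qL y)); have := bl_norm_le y0; rewrite normr0 => ny.
by rewrite -(mulr0 L) ler_wpM2l.
Qed.

Lemma envelope_sum q (u : nat -> E) n : bounded_subadditive q ->
  (forall k, bl_le 0 (u k)) ->
  envelope q (\sum_(k < n) u k) <= \sum_(k < n) envelope q (u k).
Proof.
move=> bq u0; elim: n => [|n IHn]; first by rewrite !big_ord0 envelope0.
rewrite !big_ord_recr/=.
by apply: (le_trans (envelopeD bq _ (u0 n))); [exact: bl_sum_ge0|rewrite lerD2r].
Qed.

(** For superadditivity, both [u + v] and [u - v] are admissible for [x + z], and the larger of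
    [|l (u + v)|] and [|l (u - v)|] is [|l u| + |l v|]. *)
Lemma envelope_linearD (l : {linear E -> R^o}) x z :
  bounded_subadditive (fun y => `|l y|) -> bl_le 0 x -> bl_le 0 z ->
  envelope (fun y => `|l y|) (x + z) =
  envelope (fun y => `|l y|) x + envelope (fun y => `|l y|) z.
Proof.
move=> bl x0 z0; apply/eqP; rewrite eq_le envelopeD//= -lerBrDr.
apply: envelope_lub => // u ux; rewrite lerBrDl -lerBrDr.
apply: envelope_lub => // v vz; rewrite lerBrDr.
have H w : bl_le (bl_mod w) z -> `|l (u + w)| <= envelope (fun y => `|l y|) (x + z).
  move=> wz; apply: (envelope_ub bl); apply: (bl_le_trans (bl_modD _ _)).
  exact: bl_leD.
have := H v vz; have := H (- v); rewrite bl_modN => /(_ vz).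
rewrite !linearD/= linearN/= !ler_norml => /andP[? ?] /andP[? ?].
by case: (ger0P (l u)) => ?; case: (ger0P (l v)) => ?; lra.
Qed.

End solid_envelope.

(** * Weak convergence, and weakly null sequences from bounded partial sums *)

Section dual_bounds.
Context {R : realType}.

Lemma weak_cvgP (V : normedModType R) (F : set_system V) (l : V) : Filter F ->
  (forall g : dual V, g x @[x --> F] --> g l) -> (F : set_system (weak V)) --> (l : weak V).
Proof.
move=> FF Fl; apply/cvg_sup => g U [/= _ [[W /= oW <-] /= Wl]] /filterS; apply.
apply: (Fl g); exact: open_nbhs_nbhs.
Qed.

Lemma weak_continuous (V : normedModType R) (g : dual V) (x : weak V) :
  g y @[y --> x] --> g x.
Proof.
move=> W Wgx; have /cvg_sup/(_ g) : nbhs x --> x by exact: cvg_id.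
by apply; exact: (@initial_continuous _ _ (dual_fun g)) Wgx.
Qed.

Context {E : banachLatticeType R}.

(* Flip the signs of the [y k] so that all [g (y k)] become nonnegative. *)
Lemma dual_abs_sum_le (g : dual E) (y z : nat -> E) (M : R) n :
  (forall k, bl_le (bl_mod (y k)) (z k)) -> `|\sum_(k < n) z k| <= M ->
  \sum_(k < n) `|g (y k)| <= dual_norm g * M.
Proof.
move=> yz zM; pose y' k := if 0 <= g (y k) then y k else - y k.
have y'E k : `|g (y k)| = g (y' k).
  rewrite /y'; case: ifPn => [/ger0_norm//|]; rewrite -ltNge linearN => /ltW.
  exact: ler0_norm.
have y'z k : bl_le (bl_mod (y' k)) (z k).
  by rewrite /y'; case: ifP => _; rewrite ?bl_modN.
under eq_bigr do rewrite y'E.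
rewrite -linear_sum.
apply: (le_trans (ler_norm _)); apply: (le_trans (ler_dual_norm _ _)).
apply: ler_wpM2l; first exact: dual_norm_ge0.
apply: le_trans zM; apply: bl_norm_le.
elim: n => [|n IHn]; first by rewrite !big_ord0 bl_mod_id; exact: bl_le_refl.
by rewrite !big_ord_recr; apply: (bl_le_trans (bl_modD _ _)); exact: bl_leD.
Qed.

(** The values of each functional along [y] are absolutely summable, so they tend to 0. *)
Lemma bl_summable_weak_null (y z : nat -> E) (M : R) :
  (forall k, bl_le (bl_mod (y k)) (z k)) ->
  (forall n, `|\sum_(k < n) z k| <= M) ->
  (y : nat -> weak E) @ \oo --> ((0 : E) : weak E).
Proof.
move=> yz zM; apply: weak_cvgP => g; rewrite linear0; apply/cvgr0Pnorm_lt.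
have : (fun k => `|g (y k)|) @ \oo --> (0 : R).
  apply: cvg_series_cvg_0; apply: nondecreasing_is_cvgn.
    by apply: nondecreasing_series => k _ _; exact: normr_ge0.
  exists (dual_norm g * M) => _ [n _ <-]; rewrite /series/= big_mkord.
  exact: dual_abs_sum_le (zM n).
by move=> /cvgr0Pnorm_lt H e e0; near=> k; rewrite -[ltLHS]normr_id; near: k; exact: H.
Unshelve. all: by end_near. Qed.

End dual_bounds.

(** * Bounded functionals and norming functionals *)

Section norming.
Context {R : realType} (V : normedModType R).

Lemma bounded_linear_dual (f : {linear V -> R^o}) (L : R) : 0 <= L ->
  (forall x, f x <= L * `|x|) ->
  exists2 g : dual V, (forall x, g x = f x) & dual_norm g <= L.
Proof.
move=> L0 fL.
have nfL x : `|f x| <= L * `|x|.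
  by rewrite ler_norml fL andbT lerNl -linearN -(normrN x); exact: fL.
have cf : continuous f.
  apply: bounded_linear_continuous; apply/bounded_funP => r.
  exists (L * r) => x xr; apply: (le_trans (nfL x)); exact: ler_wpM2l.
have fd : (f : V -> R^o) \in @dual_pred R V.
  by apply/asboolP; split=> //; exact: linearP.
exists (Dual fd) => //; apply: dual_norm_lub => x x1.
by apply: (le_trans (nfL x)); rewrite -[leRHS]mulr1 ler_wpM2l.
Qed.

Lemma norming_functional (x : V) :
  exists2 g : dual V, dual_norm g <= 1 & g x = `|x|.
Proof.
have sn : sublinear (fun y : V => `|y|).
  by split=> [y z|a y a0]; [exact: ler_normD|rewrite normrZ ger0_norm].
have [f [fn fx]] := hahn_banach x sn.
have [|g gf gn] := @bounded_linear_dual f 1 ler01; first by move=> y; rewrite mul1r.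
by exists g => //; rewrite gf.
Qed.

End norming.

Lemma lt_exprN2 {R : realType} (e : R) : 0 < e -> exists N, 2^-1 ^+ N < e :> R.
Proof.
move=> e0; have h : `|2^-1 : R| < 1 by rewrite ger0_norm ?invr_ge0//; lra.
have /cvgr0Pnorm_lt/(_ _ e0)[N _ /(_ N (leqnn N))] := cvg_expr h.
by rewrite /= ger0_norm ?exprn_ge0 ?invr_ge0//; exists N.
Qed.

(** * The seminorm of a Dunford-Pettis operator on a solid directed set *)

Section dunford_pettis_operators.
Context {R : realType} {E : banachLatticeType R} {X : completeNormedModType R}.
Variable T : {linear E -> X}.
Hypothesis T_dp : dunford_pettis T.
Implicit Types (x y z u v w : E) (g : dual X).

(** Otherwise suitably rescaled vectors [y n] of norm [n.+1%:R^-1] have images of norm above 1,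
    although a norm null sequence is weakly null. *)
Lemma dunford_pettis_bounded : exists2 L, 0 <= L & forall x, `|T x| <= L * `|x|.
Proof.
apply: contrapT => H.
have /choice[x xP] n : exists x, n.+1%:R * `|x| < `|T x|.
  apply: contrapT => Hn; apply: H; exists n.+1%:R => // x.
  by rewrite leNgt; apply/negP => Hx; apply: Hn; exists x.
have x0 n : 0 < `|x n|.
  rewrite normr_gt0; apply/negP => /eqP xn0; have := xP n.
  by rewrite xn0 linear0 !normr0 mulr0 ltxx.
pose y n := (n.+1%:R * `|x n|)^-1 *: x n.
have c0 n : 0 < n.+1%:R * `|x n| by rewrite mulr_gt0.
have yn n : `|y n| = n.+1%:R^-1.
  rewrite normrZ ger0_norm ?invr_ge0 ?ltW// invfM -mulrA mulVf ?mulr1//.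
  by rewrite gt_eqF.
have Ty n : 1 < `|T (y n)|.
  rewrite linearZ normrZ ger0_norm ?invr_ge0 ?ltW//.
  by rewrite ltr_pdivlMl// mulr1.
have cy : y @ \oo --> (0 : E).
  by apply/norm_cvg0P; rewrite (_ : (fun n => _) = harmonic);
    [exact: cvg_harmonic|apply/funext => n; exact: yn].
have : `|T (y n)| @[n --> \oo] --> (0 : R).
  apply: T_dp; apply: weak_cvgP => g.
  by apply: continuous_cvg cy; exact: dual_continuous.
move=> /cvgr0Pnorm_lt/(_ _ ltr01)[N _ /(_ N (leqnn N))].
by rewrite /= normr_id ltNge ltW.
Qed.

Lemma dp_subadditive : bounded_subadditive (fun x => `|T x|).
Proof.
split; last exact: dunford_pettis_bounded.
- by move=> x y; rewrite linearD; exact: ler_normD.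
- by move=> x; exact: normr_ge0.
Qed.

Lemma dual_comp_le g x : dual_norm g <= 1 -> `|g (T x)| <= `|T x|.
Proof.
move=> g1; apply: (le_trans (ler_dual_norm g (T x))).
by rewrite -[leRHS]mul1r ler_wpM2r.
Qed.

Lemma dual_comp_subadditive g : dual_norm g <= 1 ->
  bounded_subadditive (fun x => `|g (T x)|).
Proof.
move=> g1; have [_ _ [L L0 TL]] := dp_subadditive; split.
- by move=> x y; rewrite !linearD; exact: ler_normD.
- by move=> x; exact: normr_ge0.
- by exists L => // x; apply: le_trans (dual_comp_le x g1) (TL x).
Qed.

Let p := envelope (fun x => `|T x|).
Let h g := envelope (fun x => `|g (T x)|).

Lemma dual_envelope_le g x : dual_norm g <= 1 -> bl_le 0 x -> h g x <= p x.
Proof.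
move=> g1 x0; apply: envelope_le => //; first exact: dp_subadditive.
by move=> y; exact: dual_comp_le.
Qed.

Lemma dual_envelopeD g x y : dual_norm g <= 1 -> bl_le 0 x -> bl_le 0 y ->
  h g (x + y) = h g x + h g y.
Proof.
move=> g1 x0 y0.
exact: (@envelope_linearD _ _ (g \o T : {linear E -> R^o}) x y
  (dual_comp_subadditive g1)).
Qed.

(** Otherwise vectors [y k] with modulus below [z k] and [|T (y k)|] above [e] would form a weakly
    null sequence. *)
Lemma dp_summable (z : nat -> E) (M e : R) : 0 < e -> (forall k, bl_le 0 (z k)) ->
  (forall n, `|\sum_(k < n) z k| <= M) -> exists k, p (z k) <= e.
Proof.
move=> e0 z0 zM; apply: contrapT => H.
have /choice[y yP] k : exists y, bl_le (bl_mod y) (z k) /\ e < `|T y|.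
  have : e < p (z k) by rewrite ltNge; apply/negP => pe; apply: H; exists k.
  by move=> /(envelope_gt (z0 k))[y]; exists y.
have := T_dp (bl_summable_weak_null (fun k => (yP k).1) zM).
move=> /cvgr0Pnorm_lt/(_ _ e0)[N _ /(_ N (leqnn N))].
by rewrite /= normr_id ltNge ltW// (yP N).2.
Qed.

Variable C : set E.
Hypothesis C_solid : solid_directed C.

Let C0 x : C x -> bl_le 0 x. Proof. by case: C_solid => + _ _ _; apply. Qed.

Let pS := dp_subadditive.

(** The boolean selects the direction, upward if [true]. If no [u] works, iterating a choice of
    successors gives a monotone sequence in [S] whose increments have [p] above [e]. Their partial
    sums telescope to a difference of two elements of [C], so they are bounded, against
    [dp_summable]. *)
Lemma dp_stationary (d : bool) (S : set E) x0 (e : R) : 0 < e -> S `<=` C -> S x0 ->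
  exists2 u, S u & forall x, S x ->
    (if d then bl_le u x else bl_le x u) -> p (bl_mod (x - u)) <= e.
Proof.
move=> e0 SC Sx0; apply: contrapT => H.
have /choice[F FP] u : exists x, S u ->
    [/\ S x, if d then bl_le u x else bl_le x u & e < p (bl_mod (x - u))].
  have [Su|nSu] := pselect (S u); last by exists u.
  apply: contrapT => Hu; apply: H; exists u => // x Sx ux.
  by rewrite leNgt; apply/negP => pe; apply: Hu; exists x.
pose s n := iter n F x0.
have Ss n : S (s n) by elim: n => //= n /FP[].
have [M CM] : exists M, forall x, C x -> `|x| <= M by case: C_solid.
have sumE n : \sum_(k < n) bl_mod (s k.+1 - s k) = if d then s n - s 0 else s 0 - s n.
  elim: n => [|n IHn]; first by rewrite big_ord0 subrr if_same.
  rewrite big_ord_recr/= IHn; have [_ + _] := FP _ (Ss n).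
  case: (d) => sn.
    by rewrite bl_mod_id -?bl_leP0// addrC addrA subrK.
  by rewrite -bl_modN opprB bl_mod_id -?bl_leP0// addrA subrK.
have [k|n|k pk] := @dp_summable (fun k => bl_mod (s k.+1 - s k)) (M + M) e e0.
- exact: bl_mod_ge0.
- rewrite sumE; case: (d); apply: (le_trans (ler_normB _ _)); apply: lerD;
  by apply/CM/SC.
- by have [_ _] := FP _ (Ss k); rewrite ltNge pk.
Qed.

(** An upward stationary [u] works, since [bl_join u x] exceeds [u] by exactly [bl_pos (x - u)]. *)
Lemma dp_cofinal x0 (e : R) : 0 < e -> C x0 ->
  exists2 u, C u & forall x, C x -> p (bl_pos (x - u)) <= e.
Proof.
move=> e0 Cx0; have [u Cu H] := dp_stationary true e0 (@subset_refl _ C) Cx0.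
exists u => // x Cx; have [_ _ Cj _] := C_solid.
have := H _ (Cj _ _ Cu Cx) (bl_joinl _ _).
by rewrite bl_joinBpos [u + _]addrC addrK bl_mod_id//; exact: bl_pos_ge0.
Qed.


(** Take a stationary running supremum and compare it with a later one that also dominates [v k]. *)
Lemma dp_pos_join_run (v : nat -> E) (e : R) : 0 < e -> (forall k, C (v k)) ->
  exists m, forall k, p (bl_pos (v k - join_run v m)) <= e.
Proof.
move=> e0 Cv; have Cr m : C (join_run v m) by exact: join_runP.
have [||_ [m _ <-] mP] := @dp_stationary true (range (join_run v)) (join_run v 0) e e0.
- by move=> _ [m _ <-].
- by exists 0%N.
exists m => k; pose n := maxn k m.
have mn := join_run_mono v (leq_maxr k m).
have kn := le_join_run v (leq_maxl k m).
apply: le_trans (mP (join_run v n) _ mn); last by exists n.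
apply: envelope_mono => //; first exact: bl_pos_ge0.
apply: bl_pos_le; last exact: bl_mod_ge0.
by apply: bl_le_trans (bl_le_mod _); exact: bl_leD2r.
Qed.

(* Otherwise the infima [w n] of almost stationary tail suprema
   [z i ~ sup_(k >= i) v k] would almost dominate [v n], hence be [p]-Cauchy with
   [h (g n0)] bounded below, while [h (g n0) (w n)] tends to 0. *)
Lemma dp_vanishing (v : nat -> E) (g : nat -> dual X) (e : R) : 0 < e ->
  (forall k, C (v k)) -> (forall k, dual_norm (g k) <= 1) ->
  (forall j k, (j < k)%N -> h (g j) (v k) <= 2^-1 ^+ k) ->
  exists n, h (g n) (v n) <= e.
Proof.
move=> e0 Cv g1 gv.
have e40 : 0 < e / 4 by rewrite divr_gt0.
have Cvi i k : C (v (i + k)%N) by [].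
(* The errors are geometric, so that the losses of all the tails together stay below [e / 4]. *)
have /choice[m mP] i : exists m, forall k,
    p (bl_pos (v (i + k)%N - join_run (fun k => v (i + k)%N) m)) <= e / 4 * 2^-1 ^+ i.+1.
  apply: (dp_pos_join_run (v := fun k => v (i + k)%N)) => //.
  by rewrite mulr_gt0// exprn_gt0// invr_gt0.
pose z i := join_run (fun k => v (i + k)%N) (m i).
have Cz i : C (z i) by exact: join_runP.
have Cw n : C (meet_run z n) by exact: meet_runP.
have vw n k : (n <= k)%N -> p (bl_pos (v k - meet_run z n)) <= e / 4 * (1 - 2^-1 ^+ n.+1).
  elim: n => [|n IHn] nk.
    by have := mP 0%N k; rewrite add0n => /le_trans; apply; rewrite expr1; lra.
  apply: (le_trans (envelope_mono pS (bl_pos_ge0 _) (bl_pos_meet_le _ _ _))).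
  apply: (le_trans (envelopeD pS (bl_pos_ge0 _) (bl_pos_ge0 _))).
  have := lerD (IHn (ltnW nk)) (mP n.+1 (k - n.+1)%N).
  rewrite subnKC// => /le_trans; apply; rewrite -mulrDr ler_pM2l//.
  by rewrite [2^-1 ^+ n.+2]exprS; lra.
have [||_ [n0 _ <-] n0P] := @dp_stationary false (range (meet_run z)) (meet_run z 0) _ e40.
- by move=> _ [n _ <-].
- by exists 0%N.
exists n0.
have [N NP] := lt_exprN2 e40.
(* Being above [n0], [n] allows [gv n0] to be used at every index [n + k]; being above [N], it makes
   [2 * 2^-1 ^+ n] at most [e / 4]. *)
pose n := (n0 + N).+1.
have gS := dual_comp_subadditive (g1 n0).
have h1 : h (g n0) (v n0) <=
    h (g n0) (meet_run z n0) + h (g n0) (bl_pos (v n0 - meet_run z n0)).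
  rewrite -dual_envelopeD//; [|exact: C0|exact: bl_pos_ge0].
  apply: envelope_mono => //; first exact: C0.
  by rewrite addrC -bl_leBlDr; exact: bl_le_pos.
have h2 : h (g n0) (bl_pos (v n0 - meet_run z n0)) <= e / 4.
  apply: (le_trans (dual_envelope_le (g1 n0) (bl_pos_ge0 _))).
  apply: (le_trans (vw _ _ (leqnn n0))); by rewrite -[leRHS]mulr1 ler_pM2l.
have wn : bl_le (meet_run z n) (meet_run z n0).
  by apply: meet_run_mono; rewrite /n -addnS leq_addr.
have h3 : h (g n0) (meet_run z n0) <= h (g n0) (meet_run z n) + e / 4.
  have d0 : bl_le 0 (meet_run z n0 - meet_run z n) by rewrite -bl_leP0.
  rewrite -[X in h _ X <= _](subrK (meet_run z n)) dual_envelopeD//; last exact: C0.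
  rewrite addrC lerD2l; apply: (le_trans (dual_envelope_le (g1 n0) d0)).
  have := n0P (meet_run z n) _ wn; rewrite -bl_modN opprB bl_mod_id//.
  by apply; exists n.
(* The infimum lies below [z n], hence below a finite sum of the [v (n + k)], on which [h (g n0)] is
   bounded by a geometric series. *)
have h4 : h (g n0) (meet_run z n) <= 2 * 2^-1 ^+ n.
  apply: (le_trans (envelope_mono gS (C0 (Cw n)) (meet_run_le z n))).
  have v0 k : bl_le 0 (v (n + k)%N) by exact: C0.
  apply: (le_trans (envelope_mono gS (C0 (Cz n)) (join_run_le_sum (m n) v0))).
  apply: (le_trans (envelope_sum _ gS v0)).
  have S k : \sum_(i < k) envelope (fun x => `|g n0 (T x)|) (v (n + i)%N) <=
      2 * 2^-1 ^+ n * (1 - 2^-1 ^+ k).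
    elim: k => [|k IHk]; first by rewrite big_ord0 expr0 subrr mulr0.
    rewrite big_ord_recr/=; have := gv n0 (n + k)%N; rewrite /n addSn -addnA ltnS leq_addr.
    move=> /(_ isT); rewrite -/n => gnk; apply: (le_trans (lerD IHk gnk)).
    rewrite addnA -addSn -/n exprD exprS; lra.
  apply: (le_trans (S _)); by rewrite -[leRHS]mulr1 ler_wpM2l.
have h5 : 2 * 2^-1 ^+ n <= e / 4.
  rewrite /n exprS mulrA mulfV// mul1r exprD; apply: le_trans (ltW NP).
  rewrite -[leRHS]mul1r ler_wpM2r// ?exprn_ge0 ?invr_ge0//.
  by rewrite exprn_ile1 ?invr_ge0// invf_le1// ler1n.
by lra.
Qed.

(** Otherwise, for any functionals chosen so far, some [x] in [C] is small for their sum while [p x]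
    exceeds [e]; a functional norming a suitable [T y] with [|y|] below [x] is then added to the
    list. The sequences so built contradict [dp_vanishing]. *)
Lemma dp_absolutely_continuous (e : R) : 0 < e ->
  exists (s : seq (dual X)) (d : R), [/\ 0 < d, forall g, g \in s -> dual_norm g <= 1 &
    forall x, C x -> \sum_(g <- s) h g x <= d -> p x <= e].
Proof.
move=> e0; apply: contrapT => H.
have /choice[F FP] (sk : seq (dual X) * nat) : exists xg : E * dual X,
    (forall g, g \in sk.1 -> dual_norm g <= 1) ->
    [/\ C xg.1, \sum_(g <- sk.1) h g xg.1 <= 2^-1 ^+ sk.2, dual_norm xg.2 <= 1 &
        e < h xg.2 xg.1].
  have [s1|ns1] := pselect (forall g, g \in sk.1 -> dual_norm g <= 1); last by exists (0, 0).
  apply: contrapT => Hs; apply: H; exists sk.1, (2^-1 ^+ sk.2); split => //.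
  move=> x Cx xs; rewrite leNgt; apply/negP => /(envelope_gt (C0 Cx))[y yx ey].
  have [g g1 gy] := norming_functional (T y).
  apply: Hs; exists (x, g) => _; split=> //=.
  apply: lt_le_trans ey _; rewrite -gy; apply: le_trans (ler_norm _) _.
  exact: (envelope_ub (dual_comp_subadditive g1)).
(* The list of the first [n] chosen functionals, newest first. *)
pose sq := fix sq n := if n is n'.+1 then (F (sq n', n')).2 :: sq n' else [::].
have sq1 n : forall g, g \in sq n -> dual_norm g <= 1.
  elim: n => // n IHn g; rewrite inE => /predU1P[->|/IHn//].
  by have [] := FP (sq n, n) IHn.
have P n := FP (sq n, n) (sq1 n).
have [|||n] := @dp_vanishing (fun n => (F (sq n, n)).1) (fun n => (F (sq n, n)).2) e e0.
- by move=> k; have [] := P k.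
- by move=> k; have [] := P k.
(* For [j < k] the [j]-th functional occurs in [sq k], and a single nonnegative term is at most the
   whole sum. *)
- move=> j k jk; have [Ck + _ _] := P k; apply: le_trans.
  move: (F (sq k, k)).1 Ck => x Cx; elim: k jk => // k IHk.
  have s0 : 0 <= \sum_(g <- sq k) h g x.
    rewrite big_seq sumr_ge0// => g /sq1 g1; apply: envelope_ge0 => //; last exact: C0.
    exact: dual_comp_subadditive.
  rewrite /= big_cons ltnS leq_eqVlt => /predU1P[->|/IHk]; first by rewrite lerDl.
  move=> /le_trans; apply; rewrite lerDr; apply: envelope_ge0; last exact: C0.
  by apply: dual_comp_subadditive; have [] := P k.
- by have [_ _ _] := P n; rewrite ltNge => /negP.
Qed.

End dunford_pettis_operators.

(** * Grid estimates and a uniformly convex energy *)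

Section grid.
Context {R : realType} {E : banachLatticeType R}.
Implicit Types x y z u v w a b c e m : E.

Lemma bl_le_avg t a b e : bl_le 0 e -> bl_le t a -> bl_le t b -> a + b = e -> bl_le t e.
Proof.
move=> e0 ta tb abe; apply: (@bl_leZK _ _ 2) => //.
rewrite !scaler_nat !mulr2n; apply: bl_le_trans (bl_le_addr e e0).
by rewrite -abe; exact: bl_leD.
Qed.

(** Read pointwise: a number [m] with [|m|] at most [K e] is within [e] of some multiple of [e]
    between [- K e] and [K e]; a larger one is at distance [|m| - K e] from the nearest end. *)
Lemma bl_grid w m e K : bl_le 0 e ->
  (forall k, (k <= K)%N ->
    bl_le w (bl_mod (m - e *+ k)) /\ bl_le w (bl_mod (m + e *+ k))) ->
  bl_le w (bl_join e (bl_mod m - e *+ K)).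
Proof.
move=> e0; elim: K => [|K IHK] H.
  have [+ _] := H 0%N isT; rewrite mulr0n !subr0 => /bl_le_trans; apply.
  exact: bl_joinr.
have {}IHK : bl_le w (bl_join e (bl_mod m - e *+ K)).
  by apply: IHK => k kK; apply: H; exact: leqW.
have [w1 w2] := H _ (leqnn _).
set c := e *+ K.+1 in w1 w2 *; have cE : c - e *+ K = e by rewrite /c mulrSr addrC addKr.
have joinr y : bl_le y (bl_mod m - c) -> bl_le y (bl_join e (bl_mod m - c)).
  by move=> /bl_le_trans; apply; exact: bl_joinr.
have joinl y : bl_le y e -> bl_le y (bl_join e (bl_mod m - c)).
  by move=> /bl_le_trans; apply; exact: bl_joinl.
apply: (bl_join_case IHK) => [x _|x xw xm]; first exact: joinl.
have : bl_le x (bl_join (m - e *+ K) (- m - e *+ K)).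
  apply: bl_le_trans xm _; rewrite bl_leBlDr; apply: bl_join_le.
    by rewrite -bl_leBlDr; exact: bl_joinl.
  by rewrite -bl_leBlDr; exact: bl_joinr.
(* The two cases are the signs of [m]. If the new end of the grid falls short of [m], the bound
   passes to [|m| - c]; if it overshoots, the old and new bounds add up to [e], so both cannot
   exceed [e]. *)
move=> /bl_join_case; apply=> y yx ym.
- have : bl_le y (bl_mod (m - c)) := bl_le_trans (bl_le_trans yx xw) w1.
  move=> /bl_join_case; apply=> t ty tm.
    by apply: joinr; apply: bl_le_trans tm _; apply: bl_leD2r; exact: bl_le_mod.
  apply: joinl; apply: (bl_le_avg e0 (bl_le_trans ty ym) tm).
  by rewrite opprB addrC addrA subrK cE.
- have : bl_le y (bl_mod (m + c)) := bl_le_trans (bl_le_trans yx xw) w2.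
  move=> /bl_join_case; apply=> t ty tm.
    apply: joinl; apply: (bl_le_avg e0 (bl_le_trans ty ym) tm).
    by rewrite addrC addrA [m + c]addrC addrK cE.
  apply: joinr; apply: bl_le_trans tm _; rewrite opprD.
  by apply: bl_leD2r; exact: bl_leN_mod.
Qed.

(** The midpoint convexity defect of the modulus centred at [c]: the subtracted term is twice the
    modulus of the midpoint of [z] and [z'] minus [c]. *)
Definition mod_defect z z' c :=
  bl_mod (z - c) + bl_mod (z' - c) - bl_mod (z + z' - (c + c)).

Lemma mod_defect_ge0 z z' c : bl_le 0 (mod_defect z z' c).
Proof.
rewrite /mod_defect -bl_leP0; have := bl_modD (z - c) (z' - c).
by rewrite addrACA -opprD.
Qed.

Lemma mod_sub_le_defect z z' c :
  bl_le (bl_mod (z - z')) (mod_defect z z' c + bl_mod (z + z' - (c + c))).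
Proof.
rewrite /mod_defect subrK; have := bl_modD (z - c) (- (z' - c)).
by rewrite bl_modN opprB addrA subrK.
Qed.

Definition grid_defect e K z z' :=
  \sum_(k < K.+1) (mod_defect z z' (e *+ k) + mod_defect z z' (- (e *+ k))).

(** By [mod_sub_le_defect], [|z - z'|] minus the total defect lies below the distance from [z + z']
    to every point of the grid of mesh [e + e], so [bl_grid] applies. What sticks out beyond that
    grid is at most the sum of the excesses of [|z|] and [|z'|] over [e *+ K]. *)
Lemma mod_sub_le_grid e K z z' : bl_le 0 e ->
  bl_le (bl_mod (z - z')) (grid_defect e K z z' + (e + e) +
    (bl_pos (bl_mod z - e *+ K) + bl_pos (bl_mod z' - e *+ K))).
Proof.
move=> e0; set V := grid_defect _ _ _ _; set P := bl_pos _ + bl_pos _.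
have D0 k : bl_le 0 (mod_defect z z' (e *+ k) + mod_defect z z' (- (e *+ k))).
  by apply: bl_addr_ge0; exact: mod_defect_ge0.
have DV k : (k <= K)%N ->
    bl_le (mod_defect z z' (e *+ k)) V /\ bl_le (mod_defect z z' (- (e *+ k))) V.
  move=> kK; suff kV : bl_le (mod_defect z z' (e *+ k) + mod_defect z z' (- (e *+ k))) V.
    split; apply: bl_le_trans kV; first exact/bl_le_addr/mod_defect_ge0.
    exact/bl_le_addl/mod_defect_ge0.
  rewrite /V /grid_defect (bigD1 (Ordinal (kK : (k < K.+1)%N)))//=; apply: bl_le_addr.
  by elim/big_ind: _ => //; [exact: bl_le_refl|exact: bl_addr_ge0].
have wP : bl_le (bl_mod (z - z') - V) (bl_join (e + e) (bl_mod (z + z') - (e + e) *+ K)).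
  apply: bl_grid => [|k /DV[D1 D2]]; first exact: bl_addr_ge0.
  have H c : bl_le (mod_defect z z' c) V ->
      bl_le (bl_mod (z - z') - V) (bl_mod (z + z' - (c + c))).
    move=> cV; rewrite bl_leBlDr [X in bl_le _ X]addrC.
    apply: bl_le_trans (mod_sub_le_defect z z' c) _.
    exact: bl_leD2r.
  by split; [have := H _ D1|have := H _ D2]; rewrite -?opprD ?opprK -mulrnDl.
rewrite -addrA addrC -bl_leBlDr; apply: bl_le_trans wP _.
have P0 : bl_le 0 P by apply: bl_addr_ge0; exact: bl_pos_ge0.
apply: bl_join_le; first exact: bl_le_addr.
apply: (@bl_le_trans _ _ P); last by apply: bl_le_addl; exact: bl_addr_ge0.
apply: (@bl_le_trans _ _ ((bl_mod z - e *+ K) + (bl_mod z' - e *+ K))).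
  by rewrite addrACA -opprD mulrnDl; apply: bl_leD2r; exact: bl_modD.
by apply: bl_leD; exact: bl_le_pos.
Qed.

Section additive_functional.
Variable f : E -> R.
Hypothesis fD : forall x y, bl_le 0 x -> bl_le 0 y -> f (x + y) = f x + f y.
Hypothesis f_ge0 : forall x, bl_le 0 x -> 0 <= f x.

Lemma additive_mono x y : bl_le 0 x -> bl_le x y -> f x <= f y.
Proof.
move=> x0 xy; have yx : bl_le 0 (y - x) by rewrite -bl_leP0.
by rewrite -(subrK x y) fD// lerDr f_ge0.
Qed.

Lemma additive0 : f 0 = 0.
Proof. by have := fD (bl_le_refl 0) (bl_le_refl 0); rewrite addr0; lra. Qed.

Lemma additiveMn x k : bl_le 0 x -> bl_le 0 (x *+ k) /\ f (x *+ k) = f x *+ k.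
Proof.
move=> x0; elim: k => [|k [k0 fk]]; first
  by rewrite !mulr0n additive0; split => //; exact: bl_le_refl.
by rewrite !mulrS fD// fk; split => //; exact: bl_addr_ge0.
Qed.

Lemma additive_sum (F : nat -> E) n : (forall k, bl_le 0 (F k)) ->
  f (\sum_(k < n) F k) = \sum_(k < n) f (F k).
Proof.
move=> F0; elim: n => [|n IHn]; first by rewrite !big_ord0 additive0.
by rewrite !big_ord_recr/= fD// ?IHn//; exact: bl_sum_ge0.
Qed.

(* A discretization of the squared L^2 norm [x |-> f (x ^ 2 / u)] with
   [u = e *+ K], of which only the uniform convexity matters. *)
Definition grid_energy e K z :=
  \sum_(k < K.+1) (f (bl_mod (z - e *+ k)) + f (bl_mod (z + e *+ k))).

Lemma grid_energy_ge0 e K z : 0 <= grid_energy e K z.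
Proof. by apply: sumr_ge0 => k _; apply: addr_ge0; apply/f_ge0/bl_mod_ge0. Qed.

Lemma grid_energy_le e K z : bl_le 0 e ->
  grid_energy e K z <= (f (bl_mod z) + f e *+ K) *+ 2 *+ K.+1.
Proof.
move=> e0; rewrite -[X in _ *+ X]card_ord -sumr_const; apply: ler_sum => k _.
have H c : bl_mod c = e *+ k -> f (bl_mod (z + c)) <= f (bl_mod z) + f e *+ K.
  have [ek0 fek] := additiveMn k e0.
  move=> cE; apply: (le_trans (additive_mono (bl_mod_ge0 _) (bl_modD z c))).
  rewrite fD ?cE//; last exact: bl_mod_ge0.
  rewrite fek lerD2l; by apply: ler_wpMn2l; [exact: f_ge0|rewrite -ltnS].
have ek0 := (additiveMn k e0).1.
by rewrite mulr2n; apply: lerD; apply: H; rewrite ?bl_modN bl_mod_id.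
Qed.

Lemma bl_mod_double y : bl_mod (y + y) = bl_mod y + bl_mod y.
Proof.
apply: bl_le_anti; first exact: bl_modD.
suff : bl_le (bl_mod y) (2^-1 *: bl_mod (y + y)).
  by move=> H; have := bl_leD H H; rewrite bl_half.
have h : 0 <= (2^-1 : R) by rewrite invr_ge0.
apply: bl_mod_le.
  by rewrite -{1}(bl_half y) -scalerDr; exact: bl_leZ h (bl_le_mod _).
by rewrite -{1}(bl_half y) -scalerDr -scalerN; exact: bl_leZ h (bl_leN_mod _).
Qed.

Lemma f_mod_defect z z' c : f (mod_defect z z' c) =
  f (bl_mod (z - c)) + f (bl_mod (z' - c)) - 2 * f (bl_mod (2^-1 *: (z + z') - c)).
Proof.
have -> : 2 * f (bl_mod (2^-1 *: (z + z') - c)) = f (bl_mod (z + z' - (c + c))).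
  set y := 2^-1 *: _ - c; have -> : z + z' - (c + c) = y + y.
    by rewrite /y addrACA bl_half opprD.
  by rewrite bl_mod_double fD ?mulr_natl ?mulr2n//; exact: bl_mod_ge0.
apply/eqP; rewrite eq_sym subr_eq -!fD; do ?[exact: bl_mod_ge0|exact: mod_defect_ge0].
by rewrite /mod_defect subrK.
Qed.

Lemma f_grid_defect e K z z' : f (grid_defect e K z z') =
  grid_energy e K z + grid_energy e K z' - 2 * grid_energy e K (2^-1 *: (z + z')).
Proof.
pose D k := mod_defect z z' (e *+ k) + mod_defect z z' (- (e *+ k)).
rewrite /grid_defect (@additive_sum D); last first.
  by move=> k; apply: bl_addr_ge0; exact: mod_defect_ge0.
rewrite mulr_sumr -big_split/= -sumrB; apply: eq_bigr => k _.
rewrite /D fD; [|exact: mod_defect_ge0|exact: mod_defect_ge0].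
by rewrite !f_mod_defect !opprK; lra.
Qed.

(** Apply [f] to [mod_sub_le_grid]: the value of [f] at the grid defect is the convexity defect of
    the energy, and the other terms are errors from the mesh and the truncation. *)
Lemma grid_energy_uniformly_convex e K z z' : bl_le 0 e ->
  f (bl_mod (z - z')) <=
    grid_energy e K z + grid_energy e K z' - 2 * grid_energy e K (2^-1 *: (z + z')) +
    2 * f e + (f (bl_pos (bl_mod z - e *+ K)) + f (bl_pos (bl_mod z' - e *+ K))).
Proof.
move=> e0; have V0 : bl_le 0 (grid_defect e K z z').
  apply: (@bl_sum_ge0 _ _ (fun k => mod_defect z z' (e *+ k) + mod_defect z z' (- (e *+ k)))).
  by move=> k; apply: bl_addr_ge0; exact: mod_defect_ge0.
apply: (le_trans (additive_mono (bl_mod_ge0 _) (mod_sub_le_grid K z z' e0))).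
rewrite fD; [|by do 2?apply: bl_addr_ge0|by apply: bl_addr_ge0; exact: bl_pos_ge0].
rewrite (fD V0 (bl_addr_ge0 e0 e0)).
rewrite (fD e0 e0) fD; [|exact: bl_pos_ge0|exact: bl_pos_ge0].
by rewrite f_grid_defect; lra.
Qed.

End additive_functional.
End grid.

(** * Filters with a base of midpoint-convex sets *)

Section midconvex_filters.
Context {R : realType} {V : lmodType R}.

Definition midconvex (A : set V) :=
  forall x y, A x -> A y -> A (2^-1 *: (x + y)).

Definition midconvex_filter (F : set_system V) := ProperFilter F /\
  forall A, F A -> exists B, [/\ F B, B `<=` A & midconvex B].

Lemma midconvexI A B : midconvex A -> midconvex B -> midconvex (A `&` B).
Proof. by move=> mA mB x y [Ax Bx] [Ay By]; split; [exact: mA|exact: mB]. Qed.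

Lemma midconvex_filter_refine (F : set_system V) (D : set V) :
  midconvex_filter F -> midconvex D -> (forall A, F A -> A `&` D !=set0) ->
  exists F', [/\ midconvex_filter F', F `<=` F' & F' D].
Proof.
move=> [FF Fm] mD FD; exists (filter_from F (fun A => A `&` D)); split.
- split.
    apply: filter_from_proper; last by move=> A /FD.
    apply: filter_from_filter; first by exists setT; exact: filterT.
    move=> A B FA FB; exists (A `&` B); first exact: filterI.
    by move=> x [[Ax Bx] Dx].
  move=> S [A FA AS]; have [B [FB BA mB]] := Fm A FA.
  exists (B `&` D); split; [by exists B| |exact: midconvexI].
  by move=> x [/BA Ax Dx]; exact: AS.
- by move=> A FA; exists A => // x [].
- by exists setT; [exact: filterT|move=> x []].
Qed.

(** Here [s] is the lower limit of [N] along [F], the supremum of the lower bounds of [N] on members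
    of [F]; the bound [M] on [D] makes it finite. *)
Lemma filter_near_liminf (F : set_system V) (N : V -> R) (D : set V) (M e : R) :
  ProperFilter F -> F D -> (forall x, 0 <= N x) -> (forall x, D x -> N x <= M) ->
  0 < e ->
  exists2 s, (exists2 A, F A & forall x, A x -> s - e <= N x) &
    forall A, F A -> exists2 x, A x & N x < s + e.
Proof.
move=> FF FD N0 NM e0.
pose S := [set r | exists2 A, F A & forall x, A x -> r <= N x].
have supS : has_sup S.
  split; first by exists 0, setT => //; exact: filterT.
  exists M => r [A FA Ar]; have [x [Ax Dx]] := filter_ex (filterI FA FD).
  exact: le_trans (Ar _ Ax) (NM _ Dx).
exists (sup S) => [|A FA].
  have [r [A FA Ar] sr] := sup_adherent e0 supS.
  by exists A => // x /Ar; apply: le_trans; exact: ltW.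
apply: contrapT => H; suff : sup S + e <= sup S by rewrite gerDl leNgt e0.
apply: sup_upper_bound => //; exists A => // x Ax.
by rewrite leNgt; apply/negP => Nx; apply: H; exists x.
Qed.

End midconvex_filters.

(** * Limits along filters and relative weak compactness *)

Section dunford_pettis_filters.
Context {R : realType} {E : banachLatticeType R} {X : completeNormedModType R}.
Variable T : {linear E -> X}.
Hypothesis T_dp : dunford_pettis T.
Variable C : set E.
Hypothesis C_solid : solid_directed C.
Variable x0 : E.

Let D := [set x | C (bl_mod (x - x0))].

Lemma solid_directed_half z z' : C (bl_mod z) -> C (bl_mod z') ->
  C (bl_mod (2^-1 *: (z + z'))).
Proof.
move=> Cz Cz'; have [_ Cs Cj _] := C_solid.
apply: Cs (Cj _ _ Cz Cz') (bl_mod_ge0 _) _.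
have h : 0 <= (2^-1 : R) by rewrite invr_ge0.
apply: bl_le_trans (bl_modZ_le _ h) _.
rewrite -[X in bl_le _ X]bl_half -scalerDr; apply: bl_leZ => //.
apply: bl_le_trans (bl_modD z z') _.
by apply: bl_leD; [exact: bl_joinl|exact: bl_joinr].
Qed.

Lemma half_translate (w x y : E) :
  2^-1 *: (x + y) - w = 2^-1 *: ((x - w) + (y - w)).
Proof.
by rewrite addrACA -opprD [in RHS]scalerBr [in X in _ = _ - X]scalerDr bl_half.
Qed.

Lemma midconvex_translate : midconvex D.
Proof.
by move=> x y Dx Dy; rewrite /D/= half_translate; exact: solid_directed_half.
Qed.

(** In a midpoint-convex member where the energy is nearly bounded below by its lower limit, two
    near minimizers have a midpoint that is no better, so uniform convexity makes them close for
    [f], hence for [p]. One of them, [w], is fixed before [A] is given. *)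
Lemma dp_midconvex_filter (F : set_system E) (e : R) : 0 < e ->
  midconvex_filter F -> F D ->
  exists w, forall A, F A -> exists2 x, A x & `|T (x - w)| <= e.
Proof.
move=> e0 [FF Fm] FD.
have Cpos x : C x -> bl_le 0 x by case: C_solid => + _ _ _; exact.
have pS := dp_subadditive T_dp.
have e20 : 0 < e / 2 by rewrite divr_gt0.
have [s [d [d0 s1 sP]]] := dp_absolutely_continuous T_dp C_solid e20.
pose f x := \sum_(g <- s) envelope (fun y => `|g (T y)|) x.
have fD x y : bl_le 0 x -> bl_le 0 y -> f (x + y) = f x + f y.
  move=> xp yp; rewrite /f -big_split/=; apply: eq_big_seq => g gs.
  exact: dual_envelopeD (s1 _ gs) xp yp.
have f0 x : bl_le 0 x -> 0 <= f x.
  move=> xp; rewrite /f big_seq sumr_ge0// => g /s1 g1.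
  exact: envelope_ge0 (dual_comp_subadditive T_dp g1) xp.
have fp x : bl_le 0 x -> f x <= envelope (fun y => `|T y|) x *+ size s.
  move=> xp; rewrite /f; elim: (s) s1 => [|g s' IH] s1'; first by rewrite big_nil.
  rewrite big_cons mulrS; apply: lerD; last first.
    by apply: IH => h hs'; apply: s1'; rewrite inE hs' orbT.
  by apply: dual_envelope_le => //; apply: s1'; rewrite inE eqxx.
(* As [f] is at most [n] times [p], a value of [p] up to [e'] gives a value of [f] up to [d / 8];
   the successor keeps the denominator positive when [s] is empty. *)
pose n := size s; pose e' := d / (8 * n.+1%:R).
have e'0 : 0 < e' by rewrite divr_gt0// mulr_gt0.
have e'n : e' *+ n <= d / 8.
  rewrite -mulr_natr /e' invfM mulrA -mulrA ger_pMr ?divr_gt0//.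
  by rewrite mulrC ler_pdivrMr// mul1r ler_nat.
have [y0 Dy0] := filter_ex FD.
have [u Cu uP] := dp_cofinal T_dp C_solid e'0 Dy0.
have fu z : C (bl_mod z) -> f (bl_pos (bl_mod z - u)) <= d / 8.
  move=> Cz; apply: (le_trans (fp _ (bl_pos_ge0 _))); apply: le_trans e'n.
  by rewrite lerMn2r uP// orbT.
(* The grid reaches up to [u] in [K] steps, fine enough that its mesh [h] has [f h] at most
   [d / 16]. *)
pose K := Num.bound (16 * f u / d).
have KP : 16 * f u / d < K%:R.
  by apply: archi_boundP; rewrite divr_ge0 ?mulr_ge0 ?f0 ?ltW//; exact: Cpos.
have K0 : 0 < K%:R :> R.
  by apply: le_lt_trans KP; rewrite divr_ge0 ?mulr_ge0 ?f0 ?ltW//; exact: Cpos.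
pose h := K%:R^-1 *: u.
have h0 : bl_le 0 h by apply: bl_scale_ge0 (Cpos _ Cu); rewrite invr_ge0 ltW.
have hK : h *+ K = u by rewrite -scaler_nat /h scalerKV// gt_eqF.
have fh : f h <= d / 16.
  have [_] := additiveMn fD K h0; rewrite hK => fuE.
  rewrite -(ler_pM2r K0) mulr_natr -fuE.
  by move: KP; rewrite ltr_pdivrMr// => /ltW; lra.
pose N x := grid_energy f h K (x - x0).
have N0 x : 0 <= N x by exact: grid_energy_ge0.
have NM x : D x -> N x <= (f u + d / 8 + f h *+ K) *+ 2 *+ K.+1.
  move=> Dx; apply: (le_trans (grid_energy_le fD f0 K (x - x0) h0)).
  rewrite !lerMn2r/= lerD2r.
  apply: (@le_trans _ _ (f u + f (bl_pos (bl_mod (x - x0) - u)))).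
    rewrite -fD; [|exact: Cpos|exact: bl_pos_ge0].
    apply: (additive_mono fD f0 (bl_mod_ge0 _)).
    by rewrite [X in bl_le _ X]addrC -bl_leBlDr; exact: bl_le_pos.
  by rewrite lerD2l; exact: fu.
have d16 : 0 < d / 16 by rewrite divr_gt0.
have [t [A0 FA0 A0t] At] := filter_near_liminf FF FD N0 NM d16.
have [A1 [FA1 A1s mA1]] := Fm _ (filterI FA0 FD).
have [w A1w Nw] := At _ FA1.
exists w => A FA; have [x [Ax A1x] Nx] := At _ (filterI FA FA1).
exists x => //.
have [_ Dx] := A1s _ A1x; have [_ Dw] := A1s _ A1w.
have [Nxw _] := A1s _ (mA1 _ _ A1x A1w).
have := A0t _ Nxw; rewrite /N half_translate => Nm.
have := grid_energy_uniformly_convex fD f0 K (x - x0) (w - x0) h0.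
rewrite hK opprB addrA subrK => H.
have Hx := fu _ Dx; have Hw := fu _ Dw.
rewrite /N in Nx Nw.
(* Convexity defect below [4 d / 16], mesh [2 d / 16], truncation [2 d / 8]: in all less than
   [d]. *)
have fxw : f (bl_mod (x - w)) <= d by lra.
(* The modulus of [x - w] is bounded by a sum of two elements of [C] and may leave [C]; its half
   stays in [C], at the cost of the factor 2 absorbed by [e / 2]. *)
pose y := 2^-1 *: bl_mod (x - w).
have y_ge0 : bl_le 0 y by apply: bl_scale_ge0 (bl_mod_ge0 _); rewrite invr_ge0.
have yE : bl_mod (x - w) = y + y by rewrite /y bl_half.
have Cy : C y.
  have [_ Cs Cj _] := C_solid; apply: Cs (Cj _ _ Dx Dw) y_ge0 _.
  rewrite -[X in bl_le _ X]bl_half -scalerDr /y; apply: bl_leZ; first by rewrite invr_ge0.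
  have := bl_modD (x - x0) (- (w - x0)).
  rewrite opprB addrA subrK -opprB bl_modN => /bl_le_trans.
  by apply; apply: bl_leD; [exact: bl_joinl|exact: bl_joinr].
have py : envelope (fun x => `|T x|) y <= e / 2.
  apply: sP => //; apply: le_trans fxw; rewrite yE.
  by apply: (additive_mono fD f0) => //; exact: bl_le_addr.
apply: (le_trans (envelope_mod (x - w) pS)); rewrite yE.
by apply: (le_trans (envelopeD pS y_ge0 y_ge0)); lra.
Qed.


(** Refine [F] successively by sets whose images lie in balls of radius [2^-1 ^+ n]. The union of
    these increasing filters has a Cauchy image in the complete space [X], and all its members meet
    those of [F]. *)
Lemma dp_filter_limit (F : set_system E) : midconvex_filter F -> F D ->
  exists l : X, forall e : R, 0 < e -> forall A, F A -> exists2 x, A x & `|T x - l| < e.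
Proof.
move=> mF FD.
have e0 n : 0 < 2^-1 ^+ n :> R by rewrite exprn_gt0// invr_gt0.
have /choice[G GP] (nH : nat * set_system E) : exists H', midconvex_filter nH.2 -> nH.2 D ->
    [/\ midconvex_filter H', nH.2 `<=` H' &
        exists w, H' [set x | `|T (x - w)| <= 2^-1 ^+ nH.1]].
  have [mH|nm] := pselect (midconvex_filter nH.2); last by exists nH.2.
  have [HD|nD] := pselect (nH.2 D); last by exists nH.2.
  have [w wP] := dp_midconvex_filter (e0 nH.1) mH HD.
  have [|A /wP[x Ax xw]|H' [mH' HH' H'w]] := @midconvex_filter_refine _ _ nH.2
      [set x | `|T (x - w)| <= 2^-1 ^+ nH.1] mH.
  - move=> x y /= xw yw.
    rewrite half_translate linearZ normrZ ger0_norm ?invr_ge0// ler_pdivrMl// linearD.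
    by apply: (le_trans (ler_normD _ _)); lra.
  - by exists x.
  - by exists H' => _ _; split => //; exists w.
pose Fn := fix Fn n := if n is n'.+1 then G (n', Fn n') else F.
have FnP n : midconvex_filter (Fn n) /\ Fn n D.
  by elim: n => //= n [m d]; have [? H _] := GP (n, Fn n) m d; split=> //; exact: H.
have FnS n : Fn n `<=` Fn n.+1.
  by have [m d] := FnP n; have [] := GP (n, Fn n) m d.
have Fnle m n : (m <= n)%N -> Fn m `<=` Fn n.
  move=> /subnKC <-; elim: (n - m)%N => [|k IHk]; first by rewrite addn0.
  by rewrite addnS; exact: subset_trans IHk (FnS _).
pose Foo : set_system E := [set A | exists n, Fn n A].
have FnF n : ProperFilter (Fn n) by have [[]] := FnP n.
have FooP : ProperFilter Foo.
  split; first by move=> [n]; exact: filter_not_empty.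
  split; first by exists 0%N; exact: filterT.
    move=> A B [m Am] [n Bn]; exists (maxn m n); apply: filterI.
      exact: Fnle (leq_maxl m n) _ Am.
    exact: Fnle (leq_maxr m n) _ Bn.
  by move=> A B AB [n An]; exists n; exact: filterS An.
have cF : cvg (T x @[x --> Foo]).
  apply: cauchy_cvg; apply: cauchy_exP => e ep.
  have [n ne] := lt_exprN2 ep.
  have [m d] := FnP n; have [_ _ [w wP]] := GP (n, Fn n) m d.
  exists (T w); exists n.+1; apply: filterS wP => x /= xw.
  rewrite -ball_normE/= distrC -linearB; exact: le_lt_trans xw ne.
exists (lim (T x @[x --> Foo])) => e ep A FA.
have /cvgrPdist_lt/(_ _ ep)[n nP] := cF.
have An : Fn n A by apply: (Fnle 0%N n).
have [x [Ax xl]] := filter_ex (filterI An nP).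
by exists x => //; rewrite distrC.
Qed.

Lemma dp_relatively_weakly_compact : relatively_weakly_compact (T @` D).
Proof.
rewrite /relatively_weakly_compact compact_ultra => F FU Fcl.
pose cl := closure ((T @` D : set X) : set (weak X)).
pose G S := exists2 U : set (weak X), [/\ open U, midconvex (U : set X) & F U] &
  D `&` (T @^-1` U) `<=` S.
have GI (U : set (weak X)) : open U -> midconvex (U : set X) -> F U ->
    G (D `&` (T @^-1` U)).
  by move=> oU mU FUU; exists U.
have mG : midconvex_filter G.
  split; first split.
  - move=> [U [oU _ FUU] UD0].
    have [y [Uy /(_ U)[]]] := filter_ex (filterI FUU Fcl).
      exact: open_nbhs_nbhs.
    by move=> _ [[x Dx <-] Ux]; exact: (UD0 x).
  - split.
    + by exists setT; [split; [exact: openT| |exact: filterT]|].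
    + move=> A B [U [oU mU FUU] UA] [V [oV mV FV] VB]; exists (U `&` V).
        by split; [exact: openI|exact: midconvexI|exact: filterI].
      by move=> x [Dx [Ux Vx]]; split; [exact: UA|exact: VB].
    + by move=> A B AB [U UP UA]; exists U => //; exact: subset_trans UA AB.
  - move=> A [U [oU mU FUU] UA]; exists (D `&` (T @^-1` U)); split => //; first exact: GI.
    apply: midconvexI; first exact: midconvex_translate.
    by move=> x y Ux Uy; rewrite /preimage/= linearZ linearD; exact: mU.
have GD : G D.
  by exists setT; [split; [exact: openT| |exact: filterT]|move=> x []].
have [l lP] := dp_filter_limit mG GD.
have Flt (g : dual X) (e : R) : 0 < e -> F [set y | g y < g l + e].
  move=> ep; have [//|nF] := in_ultra_setVsetC [set y | g y < g l + e] FU.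
  (* An open half-space containing the complement, since [e / 2 < e]; norm approximation of [l] by
     points [T x] of [U] is then impossible. *)
  pose U : set (weak X) := [set y | g l + e / 2 < g y].
  have e2 : 0 < e / 2 by rewrite divr_gt0.
  have oU : open U.
    rewrite (_ : U = (g : weak X -> R^o) @^-1` [set r | g l + e / 2 < r]) //.
    apply: open_comp; first by move=> y _; exact: weak_continuous.
    exact: open_gt.
  have mU : midconvex (U : set X).
    move=> x y; rewrite /U/= => Ux Uy.
    have -> : g (2^-1 *: (x + y)) = 2^-1 * (g x + g y) by rewrite linearZ linearD.
    lra.
  have FU' : F U.
    by apply: filterS nF => y; rewrite /= /U/= => /negP; rewrite -leNgt; lra.
  have d0 : 0 < (e / 2) / (dual_norm g + 1).
    by rewrite divr_gt0// ltr_wpDl// dual_norm_ge0.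
  have [x [_ Ux] xl] := lP _ d0 _ (GI _ oU mU FU').
  have := ler_dual_norm g (T x - l); rewrite linearB => gx.
  have g1 : 0 < dual_norm g + 1 by rewrite ltr_wpDl// dual_norm_ge0.
  move: xl; rewrite ltr_pdivlMr// => xl.
  have := dual_norm_ge0 g; have := normr_ge0 (T x - l) => n0 gn0.
  have := ler_norm (g (T x) - g l); move: Ux; rewrite /U/= => Ux h.
  by exfalso; nra.
have Fl : F --> (l : weak X).
  apply: weak_cvgP => g; apply/cvgrPdist_lt => e ep.
  (* The lower estimate is the upper one for [- g]. *)
  apply: filterS (filterI (Flt g e ep) (Flt (- g) e ep)) => y /= [h1 h2].
  have {}h2 : - g y < - g l + e by [].
  by rewrite ltr_norml; apply/andP; split; lra.
exists l; split => //.
rewrite [X in X l](_ : _ = closure cl); last by apply/closure_id/closed_closure.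
move=> B Bl; have := Fl _ Bl => FB.
by have [y [cy By]] := filter_ex (filterI Fcl FB); exists y.
Qed.

End dunford_pettis_filters.

(** * Elements of [E] dominated by an element of the bidual *)

Section bidual_order.
Context {R : realType} {E : banachLatticeType R}.
Implicit Types (x y z : E) (f : dual E) (theta : dual (dual E)).

Lemma bl_posD x y : bl_le (bl_pos (x + y)) (bl_pos x + bl_pos y).
Proof.
apply: bl_pos_le; last by apply: bl_addr_ge0; exact: bl_pos_ge0.
by apply: bl_leD; exact: bl_le_pos.
Qed.

Lemma bl_posZ_le (t : R) x : 0 <= t -> bl_le (bl_pos (t *: x)) (t *: bl_pos x).
Proof.
move=> t0; apply: bl_pos_le; first exact: bl_leZ (bl_le_pos x).
exact: bl_scale_ge0 t0 (bl_pos_ge0 x).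
Qed.

Lemma bl_pos_norm x : `|bl_pos x| <= `|x|.
Proof.
apply: (@le_trans _ _ `|bl_mod x|).
  apply: bl_norm_le; rewrite bl_mod_id; last exact: bl_pos_ge0.
  by apply: bl_pos_le (bl_le_mod x) (bl_mod_ge0 x).
by apply: bl_le_norm; rewrite -!/(bl_mod _) bl_mod_id; [exact: bl_le_refl|exact: bl_mod_ge0].
Qed.

Lemma bl_pos_id x : bl_le 0 x -> bl_pos x = x.
Proof.
move=> x0; apply: bl_le_anti (bl_le_pos x).
by apply: bl_pos_le => //; exact: bl_le_refl.
Qed.

Lemma bl_pos_eq0 x : bl_le x 0 -> bl_pos x = 0.
Proof.
move=> x0; apply: bl_le_anti (bl_pos_ge0 x).
by apply: bl_pos_le => //; exact: bl_le_refl.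
Qed.

(** Apply Hahn-Banach to the sublinear map sending [x] to [q (bl_pos x)]; it vanishes at [- x] for
    positive [x], which makes the extension positive. *)
Lemma positive_functional_pos (q : E -> R) (L : R) x0 : 0 <= L ->
  (forall x y, bl_le 0 x -> bl_le 0 y -> q (x + y) <= q x + q y) ->
  (forall t x, 0 <= t -> bl_le 0 x -> q (t *: x) <= t * q x) ->
  (forall x y, bl_le 0 x -> bl_le x y -> q x <= q y) ->
  (forall x, bl_le 0 x -> q x <= L * `|x|) -> q 0 = 0 ->
  exists g : dual E, [/\ dual_le 0 g, forall x, bl_le 0 x -> g x <= q x,
    dual_norm g <= L & g x0 = q (bl_pos x0)].
Proof.
move=> L0 qD qZ q_mono qL q0.
have sq : sublinear (fun x => q (bl_pos x)).
  apply: sublinearW.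
  - by rewrite bl_pos_id//; exact: bl_le_refl.
  - move=> x y; apply: le_trans (qD _ _ (bl_pos_ge0 x) (bl_pos_ge0 y)).
    exact: q_mono (bl_pos_ge0 _) (bl_posD x y).
  - move=> t x /ltW t0; apply: le_trans (qZ _ _ t0 (bl_pos_ge0 x)).
    exact: q_mono (bl_pos_ge0 _) (bl_posZ_le x t0).
have [g' [g'q g'x0]] := hahn_banach x0 sq.
have [|g gE gL] := bounded_linear_dual (f := g') L0.
  move=> x; apply: (le_trans (g'q x)); apply: (le_trans (qL _ (bl_pos_ge0 x))).
  by rewrite ler_wpM2l// bl_pos_norm.
exists g; split=> //; last by rewrite gE.
  move=> x xp; have : g' (- x) <= 0.
    by apply: (le_trans (g'q _)); rewrite bl_pos_eq0 ?q0// -oppr0; exact: bl_leN2.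
  by rewrite linearN oppr_le0 -gE.
by move=> x xp; rewrite gE -{2}(bl_pos_id xp).
Qed.

Lemma positive_dual_mono f x y : dual_le 0 f -> bl_le x y -> f x <= f y.
Proof.
by move=> f0 /bl_leP0 xy; have : 0 <= f (y - x) := f0 _ xy; rewrite linearB subr_ge0.
Qed.

(** Split [f] as [(f - g) + g] with both parts positive and [g (y - x) = f (bl_pos (y - x))]. Then
    the value of [f] at the join is [(f - g) x + g y], and each hypothesis bounds one term. *)
Lemma bidual_le_join theta x y : bidual_le (bidual_embed x) theta ->
  bidual_le (bidual_embed y) theta -> bidual_le (bidual_embed (bl_join x y)) theta.
Proof.
move=> xt yt f f0.
have [|a b a0 b0|t a t0 a0|a b a0 ab|a a0||g [g0 gf _ gxy]] :=
    @positive_functional_pos f (dual_norm f) (y - x).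
- exact: dual_norm_ge0.
- by rewrite linearD.
- by rewrite linearZ.
- exact: positive_dual_mono.
- exact: le_trans (ler_norm _) (ler_dual_norm f a).
- exact: linear0.
have fg0 : dual_le 0 (f - g).
  by move=> z z0; change (0 <= f z - g z); rewrite subr_ge0; exact: gf.
have gt : g y <= theta g := yt _ g0.
have fgt : f x - g x <= theta (f - g) := xt _ fg0.
have fxy : f (bl_join x y) = f x + f (bl_pos (y - x)) by rewrite bl_joinBpos linearD.
have thetaE : theta f = theta (f - g) + theta g by rewrite -linearD subrK.
by change (f (bl_join x y) <= theta f); rewrite linearB in gxy; lra.
Qed.

(** A positive element has a positive norming functional of norm at most 1, at which the order bound
    can be evaluated. *)
Lemma bidual_le_norm theta x : bl_le 0 x -> bidual_le (bidual_embed x) theta ->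
  `|x| <= `|theta|.
Proof.
move=> x0 xt.
have [|a b a0 b0|t a t0 a0|a b a0 ab|a a0||g [g0 _ g1 gx]] :=
    @positive_functional_pos (fun x => `|x|) 1 x.
- exact: ler01.
- exact: ler_normD.
- by rewrite normrZ ger0_norm.
- by apply: bl_norm_le; rewrite bl_mod_id.
- by rewrite mul1r.
- exact: normr0.
rewrite bl_pos_id// in gx; rewrite -gx.
have gt : g x <= theta g := xt _ g0.
apply: (le_trans gt); apply: (le_trans (ler_norm _)).
apply: (le_trans (ler_dual_norm theta g)).
by rewrite -[leRHS]mulr1; apply: ler_wpM2l => //; exact: dual_norm_ge0.
Qed.

Lemma bidual_interval_solid_directed theta :
  solid_directed [set x | bl_le 0 x /\ bidual_le (bidual_embed x) theta].
Proof.
split.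
- by move=> x [].
- move=> x y [x0 xt] y0 yx; split => // f f0.
  exact: le_trans (positive_dual_mono f0 yx) (xt f f0).
- move=> x y [x0 xt] [y0 yt]; split; last exact: bidual_le_join.
  exact: bl_le_trans x0 (bl_joinl x y).
- by exists `|theta| => x [x0 xt]; exact: bidual_le_norm.
Qed.

End bidual_order.

Theorem proposition2p14 (R : realType) (E : banachLatticeType R)
  (X : completeNormedModType R) (T : {linear E -> X}) :
  dunford_pettis T -> b_weakly_compact T.
Proof.
move=> T_dp A [phi [psi Aphipsi]].
have [[x0 Ax0]|A0] := pselect (A !=set0); last first.
  have -> : A = set0 by apply/seteqP; split => // x Ax; apply: A0; exists x.
  by rewrite image_set0 /relatively_weakly_compact closure0; exact: compact0.
pose C := [set x : E | bl_le 0 x /\ bidual_le (bidual_embed x) (psi - phi)].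
have C_solid : solid_directed C by exact: bidual_interval_solid_directed.
have key x y : A x -> A y -> bidual_le (bidual_embed (x - y)) (psi - phi).
  move=> Ax Ay f f0; have [_ h1] := Aphipsi _ Ax; have [h2 _] := Aphipsi _ Ay.
  have {}h1 : f x <= psi f := h1 _ f0.
  have {}h2 : phi f <= f y := h2 _ f0.
  by change (f (x - y) <= psi f - phi f); rewrite linearB; lra.
(* The difference [x - x0] and its opposite both lie below [psi - phi], hence so does their join,
   the modulus. *)
have AD : A `<=` [set x | C (bl_mod (x - x0))].
  move=> x Ax; split; first exact: bl_mod_ge0.
  by apply: bidual_le_join; [exact: key|rewrite opprB; exact: key].
have := @dp_relatively_weakly_compact _ _ _ _ T_dp _ C_solid x0.
move=> cD; apply: (subclosed_compact _ cD); first exact: closed_closure.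
exact/closure_subset/image_subset.
Qed.
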